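(* Assume the setting and standing assumptions given in the context, let $T\ge 0$ be the number from assumption (ii), and let $t_1>T$. Let the sequence $\{\varphi_j\}_{j\ge1}$ of eigenvectors of $A$ form a Riesz basis in $X$. Then the equation $\dot x(t)=Ax(t)+bu(t)$, $x(0)=x_0$, is exact null-controllable on $[0,t_1]$ by controls vanishing after time moment $t_1-T$ if and only if the sequence of functions $\{e^{-\lambda_jt}b_j,\ t\in[0,t_1-T]\}$, $j=1,2,\dots$, where $b_j=(b,\psi_j)$, is strongly minimal in $L_2[0,t_1-T]$.
   Context: Setting: $X$ is a separable complex Hilbert space; $A$ is the infinitesimal generator of a strongly continuous ($C_0$) semigroup $S(t)$ on $X$. $W\subset X\subset V$ are Hilbert spaces with continuous dense injections, where $W=D(A^* )$ with the graph norm and $V=W^*$ is its dual with respect to the pivot space $X$. For each $t\ge 0$, $S(t)$ extends uniquely to a bounded operator $\mathcal S(t)$ on $V$, and $\mathcal S(t)$ is a $C_0$-semigroup on $V$ whose generator extends $A$ and has domain $X$. The control space is $U=\mathbb C$ (one input), and the (possibly unbounded) input operator is $u\mapsto bu$ with a fixed $b\in V$. $(\cdot,\cdot)$ denotes the inner product of $X$ and also its extension to the duality pairing of $V$ with $W$. The mild solution of $\dot x(t)=Ax(t)+bu(t)$, $x(0)=x_0\in X$, is $x(t,x_0,u(\cdot))=S(t)x_0+\int_0^t\mathcal S(t-\tau)bu(\tau)\,d\tau$ (Bochner integral in $V$). It is assumed that $\int_0^t\mathcal S(t-\tau)bu(\tau)\,d\tau\in X$ for all $u(\cdot)\in L_2^{\rm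 loc}[0,+\infty)$ and $t\ge0$. Standing assumptions on $A$: (i) $A$ has purely point spectrum $\sigma$ with no finite limit points, and all eigenvalues have (algebraic) multiplicity $1$. (ii) There exists $T\ge0$ such that every mild solution of $\dot x(t)=Ax(t)$ expands in a series of eigenvectors of $A$ which converges uniformly in $t\in[T_1,T_2]$ for any $T<T_1<T_2$. (When the eigenvectors form a Riesz basis one can take $T=0$.) Notation: $\lambda_j$, $j=1,2,\dots$, are the eigenvalues of $A$, enumerated in order of non-decreasing absolute value; $\varphi_j$ and $\psi_j$ are corresponding eigenvectors of $A$ and $A^*$ ($A\varphi_j=\lambda_j\varphi_j$, $A^*\psi_j=\overline{\lambda_j}\psi_j$), normalized so that $(\varphi_k,\psi_j)=\delta_{kj}$. The number $b_j=(b,\psi_j)$ is well defined since $\psi_j\in W$, $b\in V$. $L_2[0,s]$ is the space of complex-valued square integrable functions. Definition: the equation is exact null-controllable on $[0,t_1]$ by controls vanishing after time moment $t_2$ if for each $x_0\in X$ there is a control $u(\cdot)\in L_2[0,t_2]$, with $u(t)=0$ a.e. on $[t_2,+\infty)$, such that $x(t_1,x_0,u(\cdot))=0$. Definition: a sequence $\{x_j\}_{j\ge1}$ in a Hilbert space is strongly minimal if $\lim_{n\to\infty}\gamma_n^{\min}>0$, where $\gamma_n^{\min}$ is the minimal eigenvalue of the Gram matrix $\{(x_i,x_j)\}_{i,j=1}^n$ (a non-increasing nonnegative sequence). *)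

(* Defs.v *)
From HB Require Import structures.
From mathcomp Require Export all_boot all_order all_algebra.
From mathcomp Require Export all_classical all_reals all_analysis.
From mathcomp Require Export complex.

Set Implicit Arguments.
Unset Strict Implicit.
Unset Printing Implicit Defensive.

Export Order.TTheory GRing.Theory Num.Theory.
Export numFieldNormedType.Exports.

(* The real-valued parts, rather than the ['Re] and ['Im] of [Num]. *)
Local Notation Re := complex.Re.
Local Notation Im := complex.Im.

Global Open Scope classical_set_scope.
Global Open Scope complex_scope.
Global Open Scope ring_scope.

Definition separable_space (T : topologicalType) :=
  exists2 D : set T, countable D & dense D.

Section HilbertSpace.
Context {R : realType} {X : completeNormedModType R[i]}.
Implicit Types ip : {dot X for @Num.conj R[i]}.

(* [ip] is linear in its first argument and conjugate-linear in the second;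
   the topology of [X] is the one it induces. *)
Definition hilbert_product ip := forall x : X, ip x x = `|x| ^+ 2.

Definition orthonormal_basis ip (e : nat -> X) :=
  (forall i j, ip (e i) (e j) = (i == j)%:R) /\
  dense [set x | exists n (c : nat -> R[i]), x = \sum_(j < n) c j *: e j].

(* The image of an orthonormal basis under a bounded operator with bounded
   everywhere defined inverse. *)
Definition riesz_basis ip (phi : nat -> X) :=
  exists (e : nat -> X) (Q Q' : {linear X -> X}),
    [/\ orthonormal_basis ip e, continuous Q /\ continuous Q',
        cancel Q Q', cancel Q' Q & forall j, Q (e j) = phi j].

End HilbertSpace.

(* An unbounded operator is represented by its graph: [A x y] means that [x] is
   in the domain of [A] and that its image is [y]. *)
Section Operators.
Context {R : realType} {X : completeNormedModType R[i]}.
Implicit Types (A : X -> X -> Prop) (S : R -> {linear X -> X}) (l : R[i]).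

Definition dom A : set X := [set x | exists y, A x y].

(* The values of [S] at negative times are irrelevant. *)
Record C0_semigroup S : Prop := {
  C0_bounded : forall t, 0 <= t -> continuous (S t);
  C0_zero : forall x, S 0 x = x;
  C0_add : forall s t x, 0 <= s -> 0 <= t -> S (s + t) x = S s (S t x);
  C0_cvg : forall x, S t x @[t --> 0^'+] --> x }.

Definition generator S : X -> X -> Prop :=
  fun x y => (t^-1)%:C *: (S t x - x) @[t --> 0^'+] --> y.

(* Single-valued as soon as [dom A] is dense. *)
Definition adjoint (ip : {dot X for @Num.conj R[i]}) A : X -> X -> Prop :=
  fun y z => forall x w, A x w -> ip w y = ip x z.

Definition resolvent_set A : set R[i]^o :=
  [set l | exists2 Rl : {linear X -> X}, continuous Rl &
     (forall y, A (Rl y) (l *: Rl y - y)) /\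
     (forall x y, A x y -> Rl (l *: x - y) = x)].

Definition spectrum A : set R[i]^o := ~` resolvent_set A.

Definition eigenvector A l (x : X) := x != 0 /\ A x (l *: x).

Definition point_spectrum A : set R[i]^o :=
  [set l | exists x, eigenvector A l x].

(* The kernel of [(A - l) ^ n]. *)
Fixpoint root_space A l (n : nat) (x : X) : Prop :=
  if n is n'.+1 then exists2 y, A x y & root_space A l n' (y - l *: x)
  else x = 0.

(* The root subspace of [l], i.e. the union of the kernels of [(A - l) ^ n],
   has dimension 1. *)
Definition algebraically_simple A l :=
  exists2 f : X, f != 0 &
    forall x, (exists n, root_space A l n x) <-> (exists c, x = c *: f).

Definition simple_discrete_spectrum A :=
  [/\ spectrum A = point_spectrum A,
      limit_point (spectrum A) = set0 &
      forall l, point_spectrum A l -> algebraically_simple A l].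

Definition eigenvalue_enumeration A (lam : nat -> R[i]) :=
  [/\ injective lam, range lam = point_spectrum A &
      forall i j, (i <= j)%N -> `|lam i| <= `|lam j|].

Definition eigenvector_expansion S (phi : nat -> X) (T : R) :=
  forall x0, exists c : nat -> R -> R[i], forall T1 T2, T < T1 -> T1 < T2 ->
    {uniform `[T1, T2],
      (fun n t => \sum_(j < n) c j t *: phi j) @ \oo --> (fun t => S t x0)}.

End Operators.

(* [Ad] is the graph of an operator on [X], [W = dom Ad] carries its graph norm,
   and functionals on [W] are functions on [X] considered on [W] only. *)
Section PivotDual.
Context {R : realType} {X : completeNormedModType R[i]}.
Implicit Types (Ad : X -> X -> Prop) (f : X -> R[i]).

Definition graph_norm (w z : X) : R[i] := sqrtC (`|w| ^+ 2 + `|z| ^+ 2).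

Definition conjugate_linear_on Ad f := forall a w w', dom Ad w -> dom Ad w' ->
  f (a *: w + w') = Num.conj a * f w + f w'.

Definition bounded_on_by Ad f (M : R[i]) :=
  forall w z, Ad w z -> `|f w| <= M * graph_norm w z.

(* [V] is, isometrically, the space of bounded conjugate-linear functionals
   [pr v] on [W], and [X] is embedded in it by the inner product, so that [pr]
   extends the inner product of [X] to [V * W].  Being conjugate-linear, the
   functionals are consistent with a linear embedding [iota]. *)
Record pivot_dual (ip : {dot X for @Num.conj R[i]}) Ad
    (V : completeNormedModType R[i]) (iota : {linear X -> V})
    (pr : V -> X -> R[i]) : Prop := {
  pivot_W_dense : dense (dom Ad);
  pivot_iota_inj : injective iota;
  pivot_iota_continuous : continuous iota;
  pivot_iota_dense : dense (range iota);
  pivot_conjugate_linear : forall v, conjugate_linear_on Ad (pr v);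
  pivot_linear : forall w, dom Ad w -> linear_for *%R (pr^~ w);
  pivot_norm : forall v M, 0 <= M -> (`|v| <= M <-> bounded_on_by Ad (pr v) M);
  pivot_onto : forall f, conjugate_linear_on Ad f ->
    (exists2 M, 0 <= M & bounded_on_by Ad f M) ->
    exists v, forall w, dom Ad w -> pr v w = f w;
  pivot_inner : forall x w, dom Ad w -> pr (iota x) w = ip x w }.

End PivotDual.

Section Bochner.
Context {R : realType} {V : completeNormedModType R[i]}.
Local Notation mu := (@lebesgue_measure R).

Record simple_function := SimpleFunction {
  sf_size : nat;
  sf_set : 'I_sf_size -> set R;
  sf_val : 'I_sf_size -> V;
  sf_measurable : forall i, measurable (sf_set i);
  sf_finite : forall i, (mu (sf_set i) < +oo)%E }.

Definition sf_eval (s : simple_function) (t : R) : V :=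
  \sum_(i < sf_size s) (\1_(sf_set i) t : R)%:C *: sf_val i.

Definition sf_integral (D : set R) (s : simple_function) : V :=
  \sum_(i < sf_size s) (fine (mu (D `&` sf_set i)))%:C *: sf_val i.

(* [f] is Bochner integrable on [D] and [v] is its integral.  Norms are
   [R[i]]-valued, with vanishing imaginary part. *)
Definition bochner_integral (D : set R) (f : R -> V) (v : V) :=
  exists s : nat -> simple_function,
    [/\ {ae mu, forall t, D t -> sf_eval (s n) t @[n --> \oo] --> f t},
        (\int[mu]_(t in D) (Re `|f t - sf_eval (s n) t|)%:E)%E
          @[n --> \oo] --> 0%E &
        sf_integral D (s n) @[n --> \oo] --> v].

End Bochner.

Section L2.
Context {R : realType}.
Local Notation mu := (@lebesgue_measure R).
Implicit Types (D : set R) (u : R -> R[i]).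

(* Measurability is Borel: every class of [L_2] has such a representative. *)
Definition square_integrable D u :=
  [/\ measurable_fun D (fun t => Re (u t)),
      measurable_fun D (fun t => Im (u t)) &
      (\int[mu]_(t in D) (Re (u t) ^+ 2 + Im (u t) ^+ 2)%:E < +oo)%E].

Definition locally_square_integrable u :=
  forall s, 0 <= s -> square_integrable `[0, s] u.

Definition complex_integral D u : R[i] :=
  (\int[mu]_(t in D) Re (u t)) +i* (\int[mu]_(t in D) Im (u t)).

Definition L2_product D u v : R[i] :=
  complex_integral D (fun t => u t * Num.conj (v t)).

Definition cexp (z : R[i]) : R[i] :=
  (expR (Re z) * cos (Im z)) +i* (expR (Re z) * sin (Im z)).

End L2.

Section StrongMinimality.
Context {R : realType}.

Definition gram (E : Type) (ip : E -> E -> R[i]) (x : nat -> E) n : 'M[R[i]]_n :=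
  \matrix_(i < n, j < n) ip (x i) (x j).

(* On [R[i]], [g%:C <= m] says that [m] is real and at least [g]. *)
Definition minimal_eigenvalue n (G : 'M[R[i]]_n) (g : R) :=
  eigenvalue G g%:C /\ forall m, eigenvalue G m -> g%:C <= m.

(* The matrices start at size 1: the empty one has no eigenvalue. *)
Definition strongly_minimal (E : Type) (ip : E -> E -> R[i]) (x : nat -> E) :=
  exists g : nat -> R,
    (forall n, minimal_eigenvalue (gram ip x n.+1) (g n)) /\
    exists2 l : R, 0 < l & g n @[n --> \oo] --> l.

End StrongMinimality.

Section Control.
Context {R : realType} {X V : completeNormedModType R[i]}.
Local Notation mu := (@lebesgue_measure R).
Variables (S : R -> {linear X -> X}) (SV : R -> {linear V -> V}).
Variables (iota : {linear X -> V}) (b : V).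

(* Together with the density of [iota] this determines [SV t] for [0 <= t]. *)
Definition semigroup_extension := C0_semigroup SV /\
  forall t x, 0 <= t -> SV t (iota x) = iota (S t x).

Definition input_map (t : R) (u : R -> R[i]) (v : V) :=
  bochner_integral `[0, t] (fun tau => SV (t - tau) (u tau *: b)) v.

(* Bochner integrals over bounded intervals of locally square integrable inputs
   exist in [V]; the condition is that they lie in the image of [X]. *)
Definition admissible_input := forall u, locally_square_integrable u ->
  forall t, 0 <= t -> exists x, input_map t u (iota x).

(* [x] is the value at time [t] of the mild solution. *)
Definition mild_solution (t : R) (x0 : X) (u : R -> R[i]) (x : X) :=
  exists2 v, input_map t u v & iota x = iota (S t x0) + v.

Definition exact_null_controllable (t1 t2 : R) :=
  forall x0, exists u : R -> R[i],
    [/\ square_integrable `[0, t2] u,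
        {ae mu, forall t, t2 <= t -> u t = 0} &
        mild_solution t1 x0 u 0].

End Control.

(* Main.v *)
Require Import Defs.
From mathcomp Require Import ring lra measurable_realfun.
Set Implicit Arguments.
Unset Strict Implicit.
Unset Printing Implicit Defensive.

(** Let D be the interval from 0 to t1 - T, b_j = pr b psi_j and
    f_j(t) = exp (- lam_j t) b_j.

    Null-controllability is a moment problem.  Pairing with psi_j diagonalizes
    the dynamics: every phi_k is multiplied by exp (lam_k t) under S t, so by
    biorthogonality and density of the span of the phi_k the number
    (S t x, psi_j) is exp (lam_j t) (x, psi_j), and by density of X in V the
    same law holds for the extended semigroup.  A bounded functional commutes
    with the Bochner integral; the psi_j-coordinate of the state reached at time
    t1 from x0 with a control u vanishing after t1 - T is thus
    exp (lam_j t1) ((x0, psi_j) + int_D f_j u).  As only 0 is orthogonal to all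
    the psi_j, the control u steers x0 to 0 exactly when int_D f_j u equals
    - (x0, psi_j) for all j.  [null_controllable_moments] expresses this with
    h = conj u, so that the integral becomes the inner product of f_j and h.

    Strong minimality is a lower Riesz bound.  The least eigenvalue of a Gram
    matrix is the minimum of its Rayleigh quotient, and the Gram form at a is the
    squared L2 norm of the combination of the f_j with coefficients a.  Hence the
    least eigenvalues decrease with the size of the matrix, and their limit is
    positive exactly when some g > 0 satisfies
    g * sum |a_j|^2 <= || sum a_j f_j ||^2 for all finite a
    ([strongly_minimal_coercive], [strongly_minimal_L2]).

    The moment problem is solvable for all data (x, psi_j), with x in X, if and
    only if this bound holds ([moments_solvable_coercive]).  The reason is that
    these data are exactly the square-summable sequences, since the phi_j are
    the image of an orthonormal basis under an isomorphism.
    If all moment problems are solvable, the functionals sum a_j (., psi_j) with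
    || sum a_j f_j || <= 1 are pointwise bounded on X, since at x each of them is
    the inner product of sum a_j f_j with a solution for x; uniform boundedness,
    tested on an x with (x, psi_j) = conj a_j, gives the lower bound.
    Conversely, the lower bound makes sum a_j f_j |-> sum a_j (x, psi_j) bounded
    on the span of the f_j, and a bounded functional is represented by an element
    of the closure of the span, obtained by minimizing a quadratic energy in the
    complete space L2 ([moment_problem], [riesz_fischer]). *)

Local Notation Re := complex.Re.
Local Notation Im := complex.Im.

(** * Real-valued norms and geometrically convergent sequences *)

(** A numeric field need not be archimedean, so the decay of [5 ^- n] is a
    hypothesis; the lemma is applied over the reals and over the complex numbers. *)
Lemma geometric_cvg {K : numFieldType} {V : completeNormedModType K}
    (x : nat -> V) (C : K) :
  (forall e, 0 < e -> \forall n \near \oo, C * (5 / 4) * (5 ^- n) < e) ->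
  (forall n, `|x n.+1 - x n| <= C * 5 ^- n) ->
  exists2 l : V, x n @[n --> \oo] --> l &
    forall n, `|l - x n| <= C * (5 / 4) * (5 ^- n).
Proof.
move=> small xS.
have C0 : 0 <= C.
  by have := le_trans (normr_ge0 _) (xS 0%N); rewrite expr0 invr1 mulr1.
have p0 n : 0 <= (5 ^- n : K) by rewrite invr_ge0 exprn_ge0.
have tail n k : `|x (n + k)%N - x n| <= C * (5 / 4) * (5 ^- n) * (1 - 5 ^- k).
  elim: k => [|k IH]; first by rewrite addn0 subrr normr0 expr0 invr1 subrr mulr0.
  rewrite addnS -(subrKA (x (n + k)%N)).
  rewrite (le_trans (ler_normD _ _))//.
  rewrite (le_trans (lerD (xS _) IH))//.
  suff -> : C * 5 ^- (n + k) + C * (5 / 4) * 5 ^- n * (1 - 5 ^- k) =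
    C * (5 / 4) * 5 ^- n * (1 - 5 ^- k.+1) by [].
  by rewrite exprD exprS; field; rewrite !expf_neq0// pnatr_eq0.
have tail' n k : `|x (n + k)%N - x n| <= C * (5 / 4) * (5 ^- n).
  rewrite (le_trans (tail _ _))// ler_piMr//.
  by rewrite !mulr_ge0.
have : cvg (x n @[n --> \oo]).
  apply/cauchy_cvgP/cauchy_exP => e e0.
  have [N _ /(_ N (leqnn N)) NP] := small _ e0.
  exists (x N); exists N => // n /= Nn.
  rewrite -ball_normE /ball_/= distrC (le_lt_trans _ NP)//.
  by rewrite -(subnKC Nn).
case/cvg_ex => l xl; exists l => // n.
apply/ler_addgt0Pr => e e0.
have /cvgrPdist_lt/(_ _ e0) [N _ NP] := xl.
have := NP (n + N)%N (leq_addl _ _) => /ltW H.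
rewrite -(subrKA (x (n + N)%N)) (le_trans (ler_normD _ _))// addrC lerD//.
Qed.

Section RealNorm.
Context {R : realType}.

(** Norms over [R[i]] are complex numbers with vanishing imaginary part; real
    values make them accessible to suprema and to linear arithmetic. *)
Definition nrm {X : normedZmodType R[i]} (x : X) : R := Re `|x|.

Section Basics.
Context {X : normedZmodType R[i]}.
Implicit Types x y : X.

Lemma nrmE x : `|x| = (nrm x)%:C.
Proof. by rewrite /nrm RRe_real// normr_real. Qed.

Lemma nrm_ge0 x : 0 <= nrm x.
Proof. by rewrite -ler0c -nrmE. Qed.

Lemma nrm0 : nrm (0 : X) = 0.
Proof. by rewrite /nrm normr0. Qed.

Lemma nrm_eq0 x : nrm x = 0 -> x = 0.
Proof. by move=> x0; apply/eqP; rewrite -normr_eq0 nrmE x0. Qed.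

Lemma ler_nrmD x y : nrm (x + y) <= nrm x + nrm y.
Proof. by rewrite -lecR rmorphD/= -!nrmE ler_normD. Qed.

Lemma nrmN x : nrm (- x) = nrm x.
Proof. by rewrite /nrm normrN. Qed.

Lemma ler_nrmB x y : nrm (x - y) <= nrm x + nrm y.
Proof. by rewrite (le_trans (ler_nrmD _ _))// nrmN. Qed.

Lemma nrm_small_eq0 x : (forall e : R, 0 < e -> nrm x <= e) -> x = 0.
Proof.
move=> H; apply/nrm_eq0/eqP; rewrite eq_le nrm_ge0 andbT.
by apply/ler_addgt0Pr => e e0; rewrite add0r H.
Qed.

End Basics.

Lemma nrmM (c d : R[i]) : nrm (c * d) = nrm c * nrm d.
Proof. by apply: (@complexI R); rewrite rmorphM/= -!nrmE normrM. Qed.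

Lemma nrmZ {X : normedModType R[i]} (c : R[i]) (x : X) : nrm (c *: x) = nrm c * nrm x.
Proof. by apply: (@complexI R); rewrite rmorphM/= -!nrmE normrZ. Qed.

Lemma nrm_sqr (c : R[i]) : nrm c ^+ 2 = Re c ^+ 2 + Im c ^+ 2.
Proof. by apply: (@complexI R); rewrite add_Re2_Im2 nrmE rmorphXn. Qed.

Lemma nrm_real (r : R) : nrm (r%:C) = `|r|.
Proof. by rewrite /nrm normc_def/= expr0n/= addr0 sqrtr_sqr. Qed.

Lemma nrm_conj (c : R[i]) : nrm (Num.conj c) = nrm c.
Proof. by rewrite /nrm norm_conjC. Qed.

Lemma ler_Re_nrm (c : R[i]) : `|Re c| <= nrm c.
Proof. by rewrite -lecR -nrmE normc_ge_Re. Qed.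

Lemma ler_Im_nrm (c : R[i]) : `|Im c| <= nrm c.
Proof.
rewrite -(@ler_pXn2r _ 2)// ?nnegrE ?nrm_ge0// nrm_sqr.
by rewrite real_normK ?num_real// lerDr sqr_ge0.
Qed.

Lemma ler_nrm_ReIm (c : R[i]) : nrm c <= `|Re c| + `|Im c|.
Proof.
rewrite -(@ler_pXn2r _ 2)// ?nnegrE ?addr_ge0 ?nrm_ge0// nrm_sqr.
rewrite sqrrD !real_normK ?num_real// -addrA lerD2l lerDr.
by rewrite mulrn_wge0// mulr_ge0.
Qed.

Section Topology.
Context {X : normedModType R[i]}.

Lemma cvg_nrmP {T : Type} (F : set_system T) {FF : Filter F} (f : T -> X) (l : X) :
  f @ F --> l <-> forall e : R, 0 < e -> \forall t \near F, nrm (f t - l) < e.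
Proof.
split=> [/cvgrPdistC_lt fl e e0|fl].
  have /fl : 0 < e%:C by rewrite ltcR.
  by apply: filterS => t; rewrite nrmE ltcR.
apply/cvgrPdistC_lt => e e0.
have eE : e = (Re e)%:C by rewrite RRe_real// gtr0_real.
have /fl : 0 < Re e by rewrite -ltcR -eE.
by apply: filterS => t; rewrite nrmE eE ltcR.
Qed.

Lemma dense_nrmP (A : set X) x (e : R) : dense A -> 0 < e ->
  exists2 y, A y & nrm (x - y) < e.
Proof.
move=> dA e0; have e0' : 0 < e%:C by rewrite ltcR.
have [|y [+ Ay]] := dA (ball x e%:C) _ (ball_open x _).
  by exists x; apply: ballxx.
by rewrite -ball_normE /ball_/= nrmE ltcR => xy; exists y.
Qed.

End Topology.

Lemma continuous_nrmP {X Y : normedModType R[i]} (f : {linear X -> Y}) :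
  continuous f -> exists2 K : R, 0 < K & forall x, nrm (f x) <= K * nrm x.
Proof.
move=> cf; have /linear_boundedP := continuous_linear_bounded 0 (cf 0).
move=> [M [Mreal MB]].
pose K := `|M| + 1.
have /MB KP : M < K by rewrite (le_lt_trans (real_ler_norm Mreal))// ltrDl.
have KE : K = (Re K)%:C by rewrite RRe_real// ger0_real// addr_ge0.
exists (Re K).
  by rewrite -ltcR -KE ltr_wpDl.
by move=> x; have := KP x; rewrite KE !nrmE -rmorphM lecR.
Qed.

Lemma geometric_small (C e : R) : 0 < e ->
  \forall n \near \oo, C * (5 / 4) * (5 ^- n) < e.
Proof.
move=> e0.
have := @cvg_geometric R (C * (5 / 4)) 5^-1.
rewrite ger0_norm ?invr_ge0// invf_lt1 ?ltr1n// => /(_ isT).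
move=> /cvgrPdistC_lt /(_ _ e0); apply: filterS => n.
rewrite /geometric/= subr0 exprVn => H.
exact: le_lt_trans (ler_norm _) H.
Qed.

Lemma nrm_cvgn {X : completeNormedModType R[i]} (x : nat -> X) :
  (forall n, nrm (x n.+1 - x n) <= (5 ^- n : R)) ->
  exists2 l : X, x n @[n --> \oo] --> l &
    forall n, nrm (l - x n) <= 5 / 4 * (5 ^- n).
Proof.
have CE n : 1 * (5 / 4) * (5 ^- n) = (5 / 4 * 5 ^- n : R)%:C.
  by rewrite mul1r !rmorphM/= !fmorphV/= rmorphXn/= !rmorph_nat.
move=> xS; have [|n|l xl lP] := @geometric_cvg _ X x 1.
- move=> e e0; have eE : e = (Re e)%:C by rewrite RRe_real// gtr0_real.
  have : 0 < Re e by rewrite -ltcR -eE.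
  move=> /(geometric_small 1); apply: filterS => n.
  by rewrite CE eE ltcR mul1r.
- by rewrite nrmE mul1r -(rmorph_nat (real_complex R)) -rmorphXn/= -fmorphV lecR.
by exists l => // n; rewrite -lecR -nrmE -CE.
Qed.

(** * Uniform boundedness *)

Section UniformBoundedness.
Context {X : completeNormedModType R[i]} {I : Type}.
Variable p : I -> X -> R.
Hypothesis pD : forall i x y, p i (x + y) <= p i x + p i y.
Hypothesis pZ : forall i (c : R) x, p i (c%:C *: x) = `|c| * p i x.
Hypothesis pb : forall i, exists K, forall x, p i x <= K * nrm x.

Lemma seminormN i x : p i (- x) = p i x.
Proof.
have := pZ i (-1) x.
by rewrite rmorphN1 scaleN1r normrN1 mul1r.
Qed.

Lemma seminorm0 i : p i 0 = 0.
Proof.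
have := pZ i 0 0.
by rewrite scaler0 normr0 mul0r.
Qed.

Lemma seminorm_ge0 i x : 0 <= p i x.
Proof.
have := pD i x (- x); rewrite subrr seminorm0 seminormN.
by rewrite -mulr2n pmulrn_lge0.
Qed.

Lemma seminorm_unit i x : p i x = nrm x * p i ((nrm x)^-1%:C *: x).
Proof.
have [x0|x0] := eqVneq (nrm x) 0.
  by rewrite x0 mul0r (nrm_eq0 x0) seminorm0.
rewrite pZ ger0_norm ?invr_ge0 ?nrm_ge0// mulrA divff// mul1r//.
Qed.

(** The norm of a seminorm, a supremum over the unit ball, need not be attained,
    but at least half of it is reached at some point of the ball. *)
Lemma seminorm_almost_attained i : exists2 y, nrm y <= 1 &
  forall x, p i x <= 2 * p i y * nrm x.
Proof.
have [K KP] := pb i.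
pose E := [set r : R | exists2 y, nrm y <= 1 & r = p i y].
have hsE : has_sup E.
  split; first by exists (p i 0), 0 => //; rewrite nrm0.
  exists `|K| => _ [y y1 ->]; rewrite (le_trans (KP _))//.
  rewrite (le_trans (ler_norm _))// normrM ler_piMr// ger0_norm ?nrm_ge0//.
have unitE x : p i x <= sup E * nrm x.
  have [x0|x0] := eqVneq (nrm x) 0.
    by rewrite x0 mulr0 (nrm_eq0 x0) seminorm0.
  rewrite seminorm_unit mulrC ler_wpM2r ?nrm_ge0//.
  apply: ub_le_sup; first by case: hsE.
  exists ((nrm x)^-1%:C *: x) => //.
  by rewrite nrmZ nrm_real ger0_norm ?invr_ge0 ?nrm_ge0// mulVf.
have [E0|E0] := leP (sup E) 0.
  exists 0; first by rewrite nrm0.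
  move=> x; rewrite seminorm0 mulr0 mul0r (le_trans (unitE _))//.
  by rewrite mulr_le0_ge0// nrm_ge0.
have [_ [y y1 ->] yP] := sup_adherent (divr_gt0 E0 (ltr0Sn R 1)) hsE.
exists y => // x; rewrite (le_trans (unitE _))// ler_wpM2r ?nrm_ge0//.
by move: yP; set s := sup E; lra.
Qed.

(** Gliding hump.  If the seminorms were not uniformly bounded, some of them would
    satisfy p_n(y_n) > 2 n 5^n at points y_n of the unit ball which almost attain
    their norms.  Add to the current sum either 5^-n y_n or its opposite: by
    the triangle inequality one of the two choices gives p_n at least 5^-n p_n(y_n).
    All later terms together change p_n by at most
    2 p_n(y_n) (5/4) 5^-(n+1), which is half of that, so p_n of the limit is at
    least n: the seminorms are unbounded at the limit. *)
Theorem uniform_boundedness :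
  (forall x, exists M, forall i, p i x <= M) ->
  exists2 M, 0 < M & forall i x, p i x <= M * nrm x.
Proof.
move=> pw; apply: contrapT => H.
have big (n : nat) : {iy : I * X | nrm iy.2 <= 1 /\
    (forall x, p iy.1 x <= 2 * p iy.1 iy.2 * nrm x) /\
    2 * n%:R * 5 ^+ n < p iy.1 iy.2}.
  apply: cid; apply: contrapT => nex; apply: H.
  exists (2 * (2 * n%:R * 5 ^+ n) + 1).
    by rewrite ltr_wpDl// !mulr_ge0// exprn_ge0.
  move=> i x; have [y y1 yP] := seminorm_almost_attained i.
  rewrite (le_trans (yP x))// ler_wpM2r ?nrm_ge0//.
  have [yn|yn] := leP (p i y) (2 * n%:R * 5 ^+ n).
    by rewrite (le_trans (ler_wpM2l _ yn))// lerDl.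
  by exfalso; apply: nex; exists (i, y).
pose ii n := (sval (big n)).1; pose yy n := (sval (big n)).2.
have y1 n : nrm (yy n) <= 1 by case: (svalP (big n)).
have yP n x : p (ii n) x <= 2 * p (ii n) (yy n) * nrm x.
  by case: (svalP (big n)) => _ [].
have yn n : 2 * n%:R * 5 ^+ n < p (ii n) (yy n).
  by case: (svalP (big n)) => _ [].
pose z n := (5 ^- n)%:C *: yy n.
pose step n x := if p (ii n) (x - z n) <= p (ii n) (x + z n) then x + z n else x - z n.
pose xx := fix f n := if n is m.+1 then step m (f m) else 0.
(* 2 z_n is the difference of the two candidates x + z_n and x - z_n. *)
have stepP n x : p (ii n) (z n) <= p (ii n) (step n x).
  have : 2 * p (ii n) (z n) <= p (ii n) (x - z n) + p (ii n) (x + z n).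
    rewrite -[2]ger0_norm// -pZ.
    have -> : 2%:C *: z n = (x + z n) - (x - z n).
      by rewrite rmorph_nat scaler_nat opprB addrC addrA subrK.
    by rewrite (le_trans (pD _ _ _))// seminormN addrC.
  rewrite /step; set a := p _ (z n); case: ifPn; rewrite -?ltNge.
    by set b := p _ (x - z n); set c := p _ (x + z n); lra.
  by set b := p _ (x - z n); set c := p _ (x + z n); lra.
have stepB n x : nrm (step n x - x) <= 5 ^- n.
  have -> : nrm (step n x - x) = nrm (z n).
    rewrite /step; case: ifP => _; first by rewrite addrAC subrr add0r.
    by rewrite addrAC subrr add0r nrmN.
  rewrite /z nrmZ nrm_real ger0_norm ?invr_ge0 ?exprn_ge0// ler_piMr//.
have [l _ lP] := @nrm_cvgn X xx (fun n => stepB n (xx n)).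
have [M MP] := pw l.
have lbig n : n%:R <= p (ii n) l.
  set P := p (ii n) (yy n).
  have h1 : p (ii n) (z n) <= p (ii n) (xx n.+1) := stepP _ _.
  have h2 : p (ii n) (xx n.+1) <= p (ii n) l + p (ii n) (l - xx n.+1).
    rewrite -[p _ (l - _)]seminormN opprB.
    by rewrite -[X in p _ X <= _](subrKC l) pD.
  have h3 := yP n (l - xx n.+1).
  have h4 := lP n.+1.
  have h5 : 2 * P * nrm (l - xx n.+1) <= 2 * P * (5 / 4 * 5 ^- n.+1).
    by rewrite ler_wpM2l// mulr_ge0// seminorm_ge0.
  have h6 : p (ii n) (z n) = 5 ^- n * P.
    by rewrite /z pZ ger0_norm// invr_ge0 exprn_ge0.
  have h7 : 2 * P * (5 / 4 * 5 ^- n.+1) = 5 ^- n * P / 2.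
    by rewrite exprS invfM; field; rewrite expf_neq0.
  have h8 : n%:R <= 5 ^- n * P / 2.
    rewrite -mulrA ler_pdivlMl ?exprn_gt0// ler_pdivlMr//.
    by have := yn n; rewrite -/P; lra.
  move: (le_trans h3 h5) h8; rewrite h7 -h6.
  move: h1 h2; set a := p _ (z n); set c := p _ (xx _).
  set d := p _ (l - _); set e := p _ l; set k := n%:R.
  by move=> *; lra.
have := lbig (Num.bound `|M|); have := MP (ii (Num.bound `|M|)).
move=> a b; have := le_trans b a; apply/negP; rewrite -ltNge.
by rewrite (le_lt_trans (ler_norm _))// archi_boundP// normr_ge0.
Qed.

End UniformBoundedness.

End RealNorm.

(** * Hilbert spaces and Riesz bases *)

Lemma dense_eq0 {R : realType} {X : normedModType R[i]} (f : X -> R[i]) (K : R)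
    (A : set X) : (forall x (e : R), 0 < e -> exists2 y, A y & nrm (x - y) < e) ->
  (forall x y, f (x - y) = f x - f y) ->
  (forall x, nrm (f x) <= K * nrm x) ->
  (forall x, A x -> f x = 0) -> forall x, f x = 0.
Proof.
move=> dA fB fK f0 x; apply: nrm_small_eq0 => d d0.
have d1 : 0 < d / (`|K| + 1) by rewrite divr_gt0// ltr_wpDl.
have [y Ay xy] := dA x _ d1.
rewrite -[f x]subr0 -(f0 _ Ay) -fB (le_trans (fK _))//.
have K1 : K <= `|K| + 1 by rewrite (le_trans (ler_norm _))// lerDl.
rewrite (le_trans (ler_wpM2r _ K1)) ?nrm_ge0// mulrC -ler_pdivlMr ?ltr_wpDl//.
exact: ltW.
Qed.

Section Hilbert.
Context {R : realType} {X : completeNormedModType R[i]}.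
Variable ip : {dot X for @Num.conj R[i]}.

Lemma ipDl x y z : ip (x + y) z = ip x z + ip y z.
Proof. exact: linearDl. Qed.
Lemma ipZl c x z : ip (c *: x) z = c * ip x z.
Proof. exact: linearZl_LR. Qed.
Lemma ipZr c x z : ip x (c *: z) = Num.conj c * ip x z.
Proof. exact: linearZr_LR. Qed.
Lemma ip_suml I r (P : pred I) (E : I -> X) z :
  ip (\sum_(i <- r | P i) E i) z = \sum_(i <- r | P i) ip (E i) z.
Proof. exact: linear_sumlz. Qed.
Lemma ip_sumr I r (P : pred I) (E : I -> X) z :
  ip z (\sum_(i <- r | P i) E i) = \sum_(i <- r | P i) ip z (E i).
Proof. exact: linear_sumr. Qed.
Lemma ipC x y : ip x y = Num.conj (ip y x).
Proof. by rewrite hermC expr0 mul1r. Qed.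

Hypothesis hX : hilbert_product ip.

Lemma ip_nrm x : ip x x = (nrm x ^+ 2)%:C.
Proof. by rewrite hX nrmE rmorphXn. Qed.

Lemma cauchy_schwarz x y : nrm (ip x y) <= nrm x * nrm y.
Proof.
have [y0|y0] := eqVneq y 0.
  by rewrite y0 linear0r !nrm0 mulr0.
have ny : 0 < nrm y.
  by rewrite lt_neqAle nrm_ge0 andbT; apply: contra y0 => /eqP/esym/nrm_eq0/eqP.
rewrite -(@ler_pXn2r _ 2)// ?nnegrE ?mulr_ge0 ?nrm_ge0//.
pose c := ip x y / ip y y.
have : 0 <= ip (x - c *: y) (x - c *: y) by exact: dnorm_ge0.
have -> : ip (x - c *: y) (x - c *: y) =
    ((nrm x) ^+ 2 - nrm (ip x y) ^+ 2 / nrm y ^+ 2)%:C.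
  have yy0 : ip y y != 0 by rewrite dnorm_eq0.
  rewrite linearBl /= !linearBr/= !ipZl !ipZr (ipC y x).
  have yyR : Num.conj (ip y y) = ip y y by rewrite -ipC.
  have cE : Num.conj c = Num.conj (ip x y) / ip y y.
    by rewrite /c rmorphM/= fmorphV/= yyR.
  rewrite cE /c.
  transitivity (ip x x - ip x y * Num.conj (ip x y) / ip y y); first by field.
  rewrite -normCK nrmE !ip_nrm -(rmorphXn (real_complex R)).
  by rewrite -(fmorphV (real_complex R)) -(rmorphM (real_complex R)) -(rmorphB (real_complex R)).
rewrite ler0c subr_ge0 ler_pdivrMr ?exprn_gt0// exprMn//.
Qed.

Section Riesz.
Variables (phi psi e : nat -> X) (Q Q' : {linear X -> X}).
Hypotheses (onb : orthonormal_basis ip e) (cQ : continuous Q) (cQ' : continuous Q').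
Hypotheses (QK : cancel Q Q') (Q'K : cancel Q' Q) (Qe : forall j, Q (e j) = phi j).
Hypothesis biorth : forall k j, ip (phi k) (psi j) = (k == j)%:R.

(** Both sides are continuous in [x] and agree on the orthonormal basis. *)
Lemma riesz_coord x j : ip (Q x) (psi j) = ip x (e j).
Proof.
apply/eqP; rewrite -subr_eq0; apply/eqP.
have [K K0 KP] := continuous_nrmP cQ.
apply: (@dense_eq0 _ _ (fun x => ip (Q x) (psi j) - ip x (e j))
  (K * nrm (psi j) + nrm (e j)) _ (fun x e => dense_nrmP x (proj2 onb))).
- by move=> y z; rewrite linearB/= !linearBl/=; ring.
- move=> y; rewrite (le_trans (ler_nrmB _ _))// mulrDl.
  rewrite (le_trans (lerD (cauchy_schwarz _ _) (cauchy_schwarz _ _)))//.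
  by rewrite [_ * nrm (e j)]mulrC lerD2r mulrAC ler_wpM2r ?nrm_ge0.
- move=> _ [n [c ->]]; rewrite linear_sum/= !ip_suml -sumrB big1// => i _.
  by rewrite linearZ/= !ipZl Qe biorth (proj1 onb) subrr.
Qed.

Lemma riesz_dense (x : X) (d : R) : 0 < d ->
  exists2 y, (exists n (c : nat -> R[i]), y = \sum_(j < n) c j *: phi j) &
    nrm (x - y) < d.
Proof.
move=> d0.
have [K K0 KP] := continuous_nrmP cQ.
have d1 : 0 < d / K by rewrite divr_gt0.
have [_ [n [c ->]] xy] := dense_nrmP (Q' x) (proj2 onb) d1.
exists (\sum_(j < n) c j *: phi j); first by exists n, c.
have -> : \sum_(j < n) c j *: phi j = Q (\sum_(j < n) c j *: e j).
  by rewrite linear_sum; apply: eq_bigr => j _; rewrite linearZ/= Qe.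
rewrite -{1}[x]Q'K -linearB (le_lt_trans (KP _))// mulrC -ltr_pdivlMr//.
Qed.

Lemma riesz_complete x : (forall j, ip x (psi j) = 0) -> x = 0.
Proof.
move=> x0; rewrite -[x]Q'K; set z := Q' x.
suff -> : z = 0 by rewrite linear0.
have ze j : ip z (e j) = 0 by rewrite -riesz_coord /z Q'K.
apply: nrm_eq0; apply/eqP; rewrite eq_le nrm_ge0 andbT.
apply/ler_addgt0Pr => d d0; rewrite add0r.
have [_ [n [c ->]] xy] := dense_nrmP z (proj2 onb) d0.
set y := \sum_(_ < _) _ in xy.
have zy : ip z y = 0.
  by rewrite ip_sumr big1// => j _; rewrite ipZr ze mulr0.
have zz : nrm z ^+ 2 <= nrm z * d.
  have := cauchy_schwarz z (z - y).
  rewrite linearBr/= zy subr0 ip_nrm nrm_real ger0_norm ?exprn_ge0 ?nrm_ge0//.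
  by move/le_trans; apply; rewrite ler_wpM2l ?nrm_ge0// ltW.
have [->|nz] := eqVneq (nrm z) 0; first exact: ltW.
by move: zz; rewrite expr2 ler_pM2l// lt_neqAle eq_sym nz nrm_ge0.
Qed.

(** The conjugates make [a |-> ip x (conj_comb n a)] linear in the coefficients. *)
Definition conj_comb (n : nat) (a : nat -> R[i]) : X :=
  \sum_(j < n) Num.conj (a j) *: e j.

Lemma nrm_conj_comb n a : nrm (conj_comb n a) ^+ 2 = \sum_(j < n) nrm (a j) ^+ 2.
Proof.
apply: (@complexI R); rewrite -ip_nrm ip_suml rmorph_sum/=.
apply: eq_bigr => j _; rewrite ipZl ip_sumr (bigD1 j)//= big1 ?addr0.
  by rewrite ipZr (proj1 onb) eqxx mulr1 conjCK mulrC -normCK nrmE rmorphXn.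
move=> i ij; rewrite ipZr (proj1 onb) [(j == i :> nat)]eq_sym val_eqE.
by rewrite (negPf ij) mulr0.
Qed.

Lemma ip_conj_comb (n : nat) (a : nat -> R[i]) x :
  \sum_(j < n) a j * ip x (psi j) = ip (Q' x) (conj_comb n a).
Proof.
rewrite ip_sumr; apply: eq_bigr => j _.
by rewrite ipZr [Num.conj (Num.conj _)]conjCK -riesz_coord Q'K.
Qed.

(** The psi-coordinates of [x] are the coordinates of [Q' x] in an orthonormal basis. *)
Lemma riesz_upper x : exists2 C : R, 0 <= C & forall n (a : nat -> R[i]),
  nrm (\sum_(j < n) a j * ip x (psi j)) ^+ 2 <= C * \sum_(j < n) nrm (a j) ^+ 2.
Proof.
exists (nrm (Q' x) ^+ 2); first by rewrite exprn_ge0 ?nrm_ge0.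
move=> n a; rewrite ip_conj_comb -nrm_conj_comb -exprMn.
rewrite ler_pXn2r ?nnegrE ?mulr_ge0 ?nrm_ge0//.
exact: cauchy_schwarz.
Qed.

(** The witness is the element whose psi-coordinates are the conjugates of the
    first [n] coefficients, the others being 0. *)
Lemma riesz_dual : exists2 K : R, 0 < K &
  forall n (a : nat -> R[i]), exists2 x : X,
  \sum_(j < n) a j * ip x (psi j) = (\sum_(j < n) nrm (a j) ^+ 2)%:C &
  nrm x ^+ 2 <= K * \sum_(j < n) nrm (a j) ^+ 2.
Proof.
have [K K0 KP] := continuous_nrmP cQ.
exists (K ^+ 2); first by rewrite exprn_gt0.
move=> n a; exists (Q (conj_comb n a)).
  by rewrite ip_conj_comb QK ip_nrm nrm_conj_comb.
by rewrite -nrm_conj_comb -exprMn ler_pXn2r ?nnegrE ?mulr_ge0 ?nrm_ge0// ltW.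
Qed.

End Riesz.
End Hilbert.

(** * Semigroups on eigenvectors of the generator *)

Section ComplexExponential.
Context {R : realType}.
Implicit Types (z w l : R[i]).

Lemma cexp0 : cexp 0 = 1 :> R[i].
Proof. by rewrite /cexp/= expR0 cos0 sin0 mulr1 mulr0. Qed.

Lemma cexpD z w : cexp (z + w) = cexp z * cexp w.
Proof.
case: z w => a b [c d]; rewrite /cexp/= expRD cosD sinD; apply/eqP.
by rewrite eq_complex/=; apply/andP; split; apply/eqP; ring.
Qed.

Lemma nrm_cexp z : nrm (cexp z) = expR (Re z).
Proof.
apply/eqP; rewrite -(@eqrXn2 _ 2) ?nrm_ge0 ?expR_ge0//; apply/eqP.
by rewrite nrm_sqr/= !exprMn -mulrDr cos2Dsin2 mulr1.
Qed.

Lemma cexpM z n : cexp (z *+ n) = cexp z ^+ n.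
Proof.
elim: n => [|n IH]; first by rewrite mulr0n cexp0 expr0.
by rewrite mulrS cexpD IH exprS.
Qed.

Lemma is_derive_right (f : R -> R) (d : R) : is_derive (0 : R) (1 : R) f d ->
  forall e : R, 0 < e -> \forall t \near 0^'+, `|f t - f 0 - d * t| <= e * t.
Proof.
move=> [fd fE] e e0.
have /cvg_dnbhs_at_right : h^-1 *: ((f \o shift 0) (h *: (1 : R)) - f 0)
    @[h --> (0 : R)^'] --> d by rewrite -fE; exact: fd.
move=> /cvgrPdistC_le /(_ _ e0).
apply: filterS2 (nbhs_right_gt (0 : R)) => t t0.
rewrite /= addr0 [t *: 1]mulr1 => H.
have -> : f t - f 0 - d * t = t * (t^-1 * (f t - f 0) - d).
  by field; rewrite gt_eqF.
by rewrite normrM gtr0_norm// mulrC ler_pM2r.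
Qed.

Lemma cexp_right l (e : R) : 0 < e ->
  \forall t \near (0 : R)^'+, nrm (cexp (l * t%:C) - 1 - l * t%:C) <= e * t.
Proof.
case: l => a b e0.
have d1 : is_derive (0 : R) (1 : R) (fun t => expR (a * t) * cos (b * t)) a.
  apply: is_derive_eq.
  by rewrite /GRing.scale/= !(mulr0, scaler0, expR0, cos0, sin0, oppr0, add0r,
    addr0, mul1r, mulr1, mul0r).
have d2 : is_derive (0 : R) (1 : R) (fun t => expR (a * t) * sin (b * t)) b.
  apply: is_derive_eq.
  by rewrite /GRing.scale/= !(mulr0, scaler0, expR0, cos0, sin0, oppr0, add0r,
    addr0, mul1r, mulr1, mul0r).
have e20 : 0 < e / 2 by rewrite divr_gt0.
have := is_derive_right d1 e20.
apply: filterS2 (is_derive_right d2 e20) => t.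
rewrite /= !mulr0 expR0 cos0 sin0 mulr1 mulr0 subr0 => H2 H1.
rewrite (le_trans (ler_nrm_ReIm _))// [e]splitr mulrDl.
by rewrite lerD// /= !mulr0 ?subr0 ?oppr0 ?addr0 ?add0r// ?subr0.
Qed.

End ComplexExponential.

Section Semigroup.
Context {R : realType} {X : completeNormedModType R[i]}.
Variable S : R -> {linear X -> X}.
Hypothesis S0 : C0_semigroup S.

(** Otherwise there are times t_n tending to 0 at which the operators have norms
    exceeding n; but [S (t n) x] tends to [x], so these operators are pointwise
    bounded, against uniform boundedness. *)
Lemma semigroup_locally_bounded : exists d M : R, [/\ 0 < d, 0 < M &
  forall t x, 0 <= t <= d -> nrm (S t x) <= M * nrm x].
Proof.
apply: contrapT => H.
have big (n : nat) : {t : R | 0 <= t <= n.+1%:R^-1 /\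
    exists x, n.+1%:R * nrm x < nrm (S t x)}.
  apply: cid; apply: contrapT => nex; apply: H; exists n.+1%:R^-1, n.+1%:R.
  split; rewrite ?invr_gt0// => t x tn.
  by rewrite leNgt; apply/negP => Sx; apply: nex; exists t; split => //; exists x.
pose t n := sval (big n).
have t1 n : 0 <= t n <= n.+1%:R^-1 by case: (svalP (big n)).
have t2 n : exists x, n.+1%:R * nrm x < nrm (S (t n) x) by case: (svalP (big n)).
have pw x : exists M, forall n, nrm (S (t n) x) <= M.
  have : S (t n) x @[n --> \oo] --> x.
    apply/cvg_nrmP => e e0.
    have /cvg_nrmP/(_ _ e0) [/= d d0 dP] := @C0_cvg _ _ _ S0 x.
    have : \forall n \near \oo, (n.+1%:R^-1 : R) < d.
      have /cvgrPdistC_lt/(_ _ d0) := @cvg_harmonic R; apply: filterS => n.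
      by rewrite /harmonic/= subr0 ger0_norm// invr_ge0.
    apply: filterS => n nd; have /andP[tn0 tn1] := t1 n.
    move: tn0; rewrite le_eqVlt => /orP[/eqP<-|tn0].
      by rewrite (C0_zero S0) subrr nrm0.
    apply: dP => //=; rewrite sub0r normrN gtr0_norm//.
    exact: le_lt_trans nd.
  move=> /cvgP/cvg_seq_bounded [M [Mr MP]]; exists (Re (M + 1)) => n.
  have /MP /(_ n Logic.I) : M < M + 1 by rewrite ltrDl.
  by rewrite /= nrmE lecE/= => /andP[].
have bdd n : exists K, forall x, nrm (S (t n) x) <= K * nrm x.
  have /andP[tn0 _] := t1 n.
  by have [K K0 KP] := continuous_nrmP (C0_bounded S0 tn0); exists K.
have subadd n x y : nrm (S (t n) (x + y)) <= nrm (S (t n) x) + nrm (S (t n) y).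
  by rewrite linearD ler_nrmD.
have homog n (c : R) x : nrm (S (t n) (c%:C *: x)) = `|c| * nrm (S (t n) x).
  by rewrite linearZ/= nrmZ nrm_real.
have [M M0 MP] := uniform_boundedness subadd homog bdd pw.
pose n := Num.bound M.
have [x Sx] := t2 n.
have := lt_le_trans Sx (MP n x); apply/negP; rewrite -leNgt.
rewrite ler_wpM2r ?nrm_ge0// -natr1 ltW// ltr_wpDr// archi_boundP// ltW//.
Qed.

Lemma semigroup_iter (s : R) (c : R[i]) x n : 0 <= s -> S s x = c *: x ->
  S (s *+ n) x = c ^+ n *: x.
Proof.
move=> s0 sx; elim: n => [|n IH]; first by rewrite mulr0n (C0_zero S0) expr0 scale1r.
rewrite mulrS (C0_add S0)// ?mulrn_wge0// IH linearZ/= sx scalerA.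
by rewrite mulrC -exprS.
Qed.

Section Eigen.
Variables (l : R[i]) (f : X).
Hypothesis fl : generator S f (l *: f).

(** Both [S t f] and [cexp (l t) f] have right derivative [l *: f] at 0. *)
Lemma eigen_right (e : R) : 0 < e ->
  \forall t \near (0 : R)^'+, nrm (S t f - cexp (l * t%:C) *: f) <= e * t.
Proof.
move=> e0.
pose e1 := e / 2 / (nrm f + 1).
have e10 : 0 < e1 by rewrite !divr_gt0// ltr_wpDl ?nrm_ge0.
have e20 : 0 < e / 2 by rewrite divr_gt0.
have := cexp_right l e10.
have /cvg_nrmP/(_ _ e20) := fl.
apply: filterS3 (nbhs_right_gt (0 : R)) => t t0 H1 H2.
have -> : S t f - cexp (l * t%:C) *: f = t%:C *: ((t^-1)%:C *: (S t f - f) - l *: f)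
    - (cexp (l * t%:C) - 1 - l * t%:C) *: f.
  rewrite scalerBr !scalerA -(rmorphM (real_complex R)) divff ?gt_eqF// scale1r.
  rewrite !scalerBl scale1r (mulrC t%:C) !opprB.
  rewrite addrACA -!addrA; congr (_ + _).
  by rewrite addNKr addKr.
rewrite (le_trans (ler_nrmB _ _))// !nrmZ nrm_real gtr0_norm//.
have H3 : nrm (cexp (l * t%:C) - 1 - l * t%:C) * nrm f <= e / 2 * t.
  rewrite (le_trans (ler_wpM2r (nrm_ge0 _) H2))// mulrAC ler_wpM2r ?(ltW t0)//.
  by rewrite /e1 mulrAC ler_pdivrMr ?ltr_wpDl ?nrm_ge0// ler_wpM2l ?(ltW e20)// lerDl.
have H4 : t * nrm ((t^-1)%:C *: (S t f - f) - l *: f) <= e / 2 * t.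
  by rewrite mulrC ler_wpM2r ?(ltW t0)// ltW.
by rewrite (le_trans (lerD H4 H3))// -mulrDl -splitr.
Qed.

(** Euler's method: cut [0, t] into n steps of length h and write
    S(h)^n f - E^n f, with E = exp (l h), as a telescoping sum of terms
    E^i S(h)^(n-1-i) (S(h) f - E f).  The powers of S(h) are bounded by M as
    t <= d, so each of the n terms is o(h) uniformly, and the sum, which does not
    depend on n, is o(1). *)
Lemma semigroup_eigen_small (d M t : R) :
  (forall s x, 0 <= s <= d -> nrm (S s x) <= M * nrm x) -> 0 <= M ->
  0 < t <= d -> S t f = cexp (l * t%:C) *: f.
Proof.
move=> MP M0 /andP[t0 td]; apply/eqP; rewrite -subr_eq0; apply/eqP.
apply: nrm_small_eq0 => e e0.
pose C := expR (`|Re l| * t).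
pose e1 := e / (t * M * C + 1).
have C0 : 0 < C by rewrite expR_gt0.
have tMC : 0 < t * M * C + 1 by rewrite ltr_wpDl// !mulr_ge0// ltW.
have e10 : 0 < e1 by rewrite divr_gt0.
have [r /= r0 rP] := eigen_right e10.
(* For steps shorter than r the error of one step is at most e1 times its length. *)
pose n := (Num.bound (t / r)).+1.
have n0 : (0 : R) < n%:R by rewrite ltr0n.
pose h := t / n%:R.
have h0 : 0 < h by rewrite divr_gt0.
have hn : h *+ n = t by rewrite -mulr_natr divfK// gt_eqF.
have hr : h < r.
  rewrite ltr_pdivrMr// mulrC -ltr_pdivrMr//.
  rewrite (lt_trans (archi_boundP _))// ?divr_ge0 ?(ltW t0) ?(ltW r0)//.
  by rewrite ltr_nat.
have hP : nrm (S h f - cexp (l * h%:C) *: f) <= e1 * h.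
  by apply: rP => //=; rewrite sub0r normrN gtr0_norm.
pose E := cexp (l * h%:C); pose K := expR (`|Re l| * h).
have K1 : 1 <= K by rewrite -expR0 ler_expR mulr_ge0// ltW.
have EK : nrm E <= K.
  rewrite nrm_cexp ler_expR.
  have -> : Re (l * h%:C) = Re l * h by case: l => a b /=; rewrite mulr0 subr0.
  by rewrite ler_wpM2r ?(ltW h0)// ler_norm.
have step m : (m <= n)%N ->
    nrm (S (h *+ m) f - E ^+ m *: f) <= m%:R * (M * (e1 * h)) * K ^+ m.
  elim: m => [_|m IH mn].
    by rewrite mulr0n (C0_zero S0) expr0 scale1r subrr nrm0 !mul0r.
  have -> : S (h *+ m.+1) f - E ^+ m.+1 *: f =
      S (h *+ m) (S h f - E *: f) + E *: (S (h *+ m) f - E ^+ m *: f).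
    rewrite mulrSr (C0_add S0) ?mulrn_wge0 ?(ltW h0)//.
    have -> : S (h *+ m) (S h f - E *: f) = S (h *+ m) (S h f) - E *: S (h *+ m) f.
      by rewrite linearB/= linearZ.
    by rewrite scalerBr scalerA -exprS addrA subrK.
  rewrite (le_trans (ler_nrmD _ _))//.
  have b1 : nrm (S (h *+ m) (S h f - E *: f)) <= M * (e1 * h).
    rewrite (le_trans (MP _ _ _)) ?ler_wpM2l//.
    rewrite mulrn_wge0 ?(ltW h0)//= (le_trans _ td)// -hn.
    by rewrite -!(mulr_natr h) ler_wpM2l ?(ltW h0)// ler_nat ltnW.
  have b2 : nrm (E *: (S (h *+ m) f - E ^+ m *: f)) <=
      K * (m%:R * (M * (e1 * h)) * K ^+ m).
    by rewrite nrmZ ler_pM ?nrm_ge0// IH// ltnW.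
  rewrite (le_trans (lerD b1 b2))//.
  have -> : m.+1%:R * (M * (e1 * h)) * K ^+ m.+1 =
    (M * (e1 * h)) * K ^+ m.+1 + K * (m%:R * (M * (e1 * h)) * K ^+ m).
    by rewrite -natr1 exprS; ring.
  by rewrite lerD2r ler_peMr ?exprn_ege1// mulr_ge0// mulr_ge0// ltW.
have := step n (leqnn _).
rewrite hn -cexpM.
have -> : (l * h%:C) *+ n = l * t%:C by rewrite -hn -mulrnAr rmorphMn.
move/le_trans; apply.
have -> : K ^+ n = C.
  by rewrite /K -expRM_natl /C -hn -[h *+ n]mulr_natl; congr expR; ring.
have -> : n%:R * (M * (e1 * h)) * C = e1 * (t * M * C).
  by rewrite -hn -mulr_natr; ring.
by rewrite /e1 mulrAC ler_pdivrMr// ler_wpM2l ?(ltW e0)// lerDl.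
Qed.

(** The law on a short interval propagates to all times by iteration. *)
Lemma semigroup_eigen t : 0 <= t -> S t f = cexp (l * t%:C) *: f.
Proof.
rewrite le_eqVlt => /orP[/eqP<-|t0].
  by rewrite (C0_zero S0) mulr0 cexp0 scale1r.
have [d [M [d0 M0 MP]]] := semigroup_locally_bounded.
pose n := (Num.bound (t / d)).+1.
have n0 : (0 : R) < n%:R by rewrite ltr0n.
pose h := t / n%:R.
have h0 : 0 < h by rewrite divr_gt0.
have hn : h *+ n = t by rewrite -mulr_natr divfK// gt_eqF.
have hd : h <= d.
  rewrite ler_pdivrMr// mulrC -ler_pdivrMr//.
  rewrite ltW// (lt_trans (archi_boundP _))// ?divr_ge0 ?(ltW t0) ?(ltW d0)//.
  by rewrite ltr_nat.
have hE : S h f = cexp (l * h%:C) *: f.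
  by apply: (semigroup_eigen_small MP (ltW M0)); rewrite h0.
rewrite -hn (semigroup_iter n (ltW h0) hE) -cexpM.
by rewrite -mulrnAr rmorphMn.
Qed.

End Eigen.
End Semigroup.

(** * Gram matrices and the lower Riesz bound *)

Section GramForm.
Context {R : realType}.
Local Open Scope sesquilinear_scope.

Lemma row_nrm n (v : 'rV[R[i]]_n) : (v *m v ^t Num.conj) 0 0 = (\sum_i nrm (v 0 i) ^+ 2)%:C.
Proof.
rewrite mxE rmorph_sum; apply: eq_bigr => i _.
by rewrite !mxE -normCK nrmE rmorphXn.
Qed.

Lemma row_nrm_gt0 n (v : 'rV[R[i]]_n) : v != 0 -> 0 < \sum_i nrm (v 0 i) ^+ 2.
Proof.
move=> v0; rewrite lt_neqAle sumr_ge0 ?andbT => [|i _]; last by rewrite exprn_ge0 ?nrm_ge0.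
apply: contra v0; rewrite eq_sym => /eqP v0; apply/eqP/rowP => i; rewrite mxE.
apply: nrm_eq0; apply/eqP; rewrite -sqrf_eq0.
have /psumr_eq0P := v0; move=> /(_ (fun j _ => exprn_ge0 2 (nrm_ge0 _))) ->//.
Qed.

(** In coordinates [w v] of a unitary eigenbasis the form is a sum of squared
    moduli weighted by the eigenvalues, so it dominates the least eigenvalue times
    the squared norm. *)
Lemma hermitian_minimal_eigenvalue n (M : 'M[R[i]]_n.+1) :
  M \is hermsymmx -> exists g : R, minimal_eigenvalue M g /\
  forall v : 'rV[R[i]]_n.+1,
    (g * \sum_i nrm (v 0 i) ^+ 2)%:C <= (v *m M *m v ^t Num.conj) 0 0.
Proof.
move=> hM.
have /orthomx_spectralP ME := hermitian_normalmx hM.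
have /mxOverP dr := hermitian_spectral_diag_real hM.
set P := spectralmx M in ME; set d := spectral_diag M in ME dr.
have uP : P \is unitarymx := spectral_unitarymx M.
rewrite (invmx_unitary uP) in ME.
pose f i := Re (d 0 i).
have dE i : d 0 i = (f i)%:C by rewrite /f RRe_real.
pose i0 := [arg min_(i < ord0) f i]%O.
have i0P i : f i0 <= f i by rewrite /i0; case: Order.TotalTheory.arg_minP => // k _; apply.
pose w (v : 'rV[R[i]]_n.+1) := v *m P ^t Num.conj.
have wP v : (v *m M *m v ^t Num.conj) 0 0 = (\sum_i f i * nrm (w v 0 i) ^+ 2)%:C.
  rewrite ME !mulmxA -/(w v) -mulmxA.
  have -> : P *m v ^t Num.conj = (w v) ^t Num.conj.
    by rewrite /w trmx_mul map_mxM trmxCK.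
  rewrite mxE rmorph_sum; apply: eq_bigr => i _.
  rewrite mul_mx_diag !mxE mulrAC -normCK nrmE dE rmorphM/= rmorphXn mulrC//.
have wn v : \sum_i nrm (w v 0 i) ^+ 2 = \sum_i nrm (v 0 i) ^+ 2.
  apply: (@complexI R); rewrite -!row_nrm /w trmx_mul map_mxM trmxCK.
  by rewrite mulmxA mulmxKtV.
have ray (v : 'rV[R[i]]_n.+1) :
    (f i0 * \sum_i nrm (v 0 i) ^+ 2)%:C <= (v *m M *m v ^t Num.conj) 0 0.
  rewrite wP lecR -wn mulr_sumr ler_sum// => i _.
  by rewrite ler_wpM2r ?exprn_ge0 ?nrm_ge0.
exists (f i0); split => //; split.
  apply/eigenvalueP; exists (row i0 P).
    rewrite -row_mul ME !mulmxA (unitarymxP uP) mul1mx row_mul row_diag_mx.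
    rewrite -scalemxAl -rowE.
    by rewrite dE.
  apply/eqP => r0; have /row_unitarymxP/(_ i0 i0) := uP.
  by rewrite r0 dotmxE mul0mx mxE eqxx => /esym/eqP; rewrite oner_eq0.
move=> m /eigenvalueP [v vM v0].
have s0 := row_nrm_gt0 v0.
have H : (v *m M *m v ^t Num.conj) 0 0 = m * (\sum_i nrm (v 0 i) ^+ 2)%:C.
  by rewrite vM -scalemxAl mxE row_nrm.
have := ray v; rewrite H rmorphM/= ler_pM2r//.
by rewrite ltcR.
Qed.

Lemma minimal_eigenvalue_uniq n (M : 'M[R[i]]_n) g g' :
  minimal_eigenvalue M g -> minimal_eigenvalue M g' -> g = g'.
Proof.
move=> [e1 m1] [e2 m2]; apply/eqP; rewrite eq_le -!lecR.
by rewrite (m1 _ e2) (m2 _ e1).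
Qed.

Section Gram.
Variables (E : Type) (ip : E -> E -> R[i]) (x : nat -> E).
Hypothesis ip_herm : forall i j, ip (x i) (x j) = Num.conj (ip (x j) (x i)).

Definition gram_form (n : nat) (a : nat -> R[i]) : R[i] :=
  \sum_(i < n) \sum_(j < n) a i * Num.conj (a j) * ip (x i) (x j).

Definition l2sum (n : nat) (a : nat -> R[i]) : R := \sum_(j < n) nrm (a j) ^+ 2.

Lemma l2sum_ge0 n a : 0 <= l2sum n a.
Proof. by rewrite sumr_ge0// => i _; rewrite exprn_ge0 ?nrm_ge0. Qed.

Lemma gram_herm n : gram ip x n \is hermsymmx.
Proof.
apply/is_hermitianmxP; rewrite expr0 scale1r; apply/matrixP => i j.
by rewrite !mxE.
Qed.

Lemma gram_formE n (a : nat -> R[i]) (v := \row_(j < n) a j) :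
  (v *m gram ip x n *m v ^t Num.conj) 0 0 = gram_form n a.
Proof.
rewrite /gram_form exchange_big mxE; apply: eq_bigr => j _.
rewrite !mxE mulr_suml; apply: eq_bigr => i _.
by rewrite !mxE mulrAC.
Qed.

(** Sequences that vanish from [n] on can be used with Gram matrices of all larger
    sizes, without casts between row vectors. *)
Lemma row_of_seq n (v : 'rV[R[i]]_n) : exists2 a : nat -> R[i],
  v = \row_(j < n) a j & forall j, (n <= j)%N -> a j = 0.
Proof.
exists (fun k => if insub k is Some j then v 0 j else 0).
  by apply/rowP => j; rewrite mxE valK.
by move=> j nj; rewrite insubF// ltnNge nj.
Qed.

Lemma gram_rayleigh n g : minimal_eigenvalue (gram ip x n.+1) g ->
  forall a, (g * l2sum n.+1 a)%:C <= gram_form n.+1 a.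
Proof.
move=> mg a; have [g' [mg' ray]] := hermitian_minimal_eigenvalue (gram_herm n.+1).
rewrite (minimal_eigenvalue_uniq mg mg').
have := ray (\row_(j < n.+1) a j); rewrite gram_formE.
by congr (_ <= _); congr ((_ * _)%:C); apply: eq_bigr => i _; rewrite mxE.
Qed.

Lemma gram_minimizer n g : minimal_eigenvalue (gram ip x n.+1) g ->
  exists a, [/\ forall j, (n.+1 <= j)%N -> a j = 0, 0 < l2sum n.+1 a &
    gram_form n.+1 a = (g * l2sum n.+1 a)%:C].
Proof.
move=> [/eigenvalueP [v vM v0] _]; have [a va a0] := row_of_seq v.
have lE : l2sum n.+1 a = \sum_i nrm (v 0 i) ^+ 2.
  by apply: eq_bigr => i _; rewrite va mxE.
exists a; split => //; first by rewrite lE row_nrm_gt0.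
by rewrite -gram_formE -va vM -scalemxAl mxE row_nrm lE rmorphM.
Qed.

(** An eigenvector of the smaller matrix, padded with zeros, is a test vector for
    the Rayleigh quotient of the larger one. *)
Lemma gram_minimal_nonincreasing n m g g' : (n <= m)%N ->
  minimal_eigenvalue (gram ip x n.+1) g -> minimal_eigenvalue (gram ip x m.+1) g' ->
  g' <= g.
Proof.
move=> nm mg mg'; have [a [a0 la E1]] := gram_minimizer mg.
have ord_ext (V : zmodType) (F : nat -> V) : (forall j, (n.+1 <= j)%N -> F j = 0) ->
    \sum_(j < m.+1) F j = \sum_(j < n.+1) F j.
  move=> F0; rewrite -!(big_mkord xpredT F) (big_cat_nat (n := n.+1))//=.
  by rewrite [X in _ + X]big_nat_cond [X in _ + X]big1 ?addr0// => j /andP[/andP[+ _] _] => /F0.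
have lE : l2sum m.+1 a = l2sum n.+1 a.
  apply: (ord_ext _ (fun j => nrm (a j) ^+ 2)) => j /a0 ->.
  by rewrite nrm0 expr0n.
have gE : gram_form m.+1 a = gram_form n.+1 a.
  rewrite /gram_form.
  have inner i : \sum_(j < m.+1) a i * Num.conj (a j) * ip (x i) (x j) =
      \sum_(j < n.+1) a i * Num.conj (a j) * ip (x i) (x j).
    apply: (ord_ext _ (fun j => a i * Num.conj (a j) * ip (x i) (x j))) => j /a0 ->.
    by rewrite conjC0 mulr0 mul0r.
  rewrite (eq_bigr _ (fun (i : 'I_m.+1) _ => inner i)).
  apply: (ord_ext _ (fun i => \sum_(j < n.+1) a i * Num.conj (a j) * ip (x i) (x j))).
  by move=> j /a0 ->; rewrite big1// => k _; rewrite !mul0r.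
have := gram_rayleigh mg' a; rewrite lE gE E1 lecR.
by rewrite ler_pM2r.
Qed.

(** The limit of the least eigenvalues bounds each of them from below, hence all
    Gram forms; conversely a lower bound of the forms bounds their eigenvalues, and
    a nonincreasing sequence that is bounded below converges. *)
Lemma strongly_minimal_coercive : strongly_minimal ip x <->
  exists2 g : R, 0 < g & forall n a, (g * l2sum n a)%:C <= gram_form n a.
Proof.
split=> [[g [gP [l l0 gl]]]|[c c0 cP]].
  have gni : nonincreasing_seq g.
    by move=> n m nm; apply: (gram_minimal_nonincreasing nm).
  have lg n : l <= g n.
    rewrite -(cvg_lim (@Rhausdorff R) gl).
    by apply: nonincreasing_cvgn_ge => //; apply/cvg_ex; exists l.
  exists l => // -[|n] a.
    by rewrite /l2sum /gram_form !big_ord0 mulr0.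
  rewrite (le_trans _ (gram_rayleigh (gP n) a))// lecR ler_wpM2r ?l2sum_ge0//.
have /choice[g gP] n : exists g, minimal_eigenvalue (gram ip x n.+1) g.
  by have [g [mg _]] := hermitian_minimal_eigenvalue (gram_herm n.+1); exists g.
have cg n : c <= g n.
  have [a [_ la E1]] := gram_minimizer (gP n).
  by have := cP n.+1 a; rewrite E1 lecR ler_pM2r.
have gni : nonincreasing_seq g.
  by move=> n m nm; apply: (gram_minimal_nonincreasing nm).
have cvg_g : cvgn g.
  apply: nonincreasing_is_cvgn => //; exists c => _ [n _ <-]; exact: cg.
exists g; split => //; exists (limn g) => //.
rewrite (lt_le_trans c0)//; apply: limr_ge => //; exact: nearW.
Qed.

End Gram.
End GramForm.

(** * Completeness of L2 over a measurable set *)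

Section RealL2.
Context {R : realType}.
Local Notation mu := (@lebesgue_measure R).
Local Notation TR := (measurableTypeR R).
Variable D : set TR.
Hypothesis mD : measurable D.
Implicit Types a b : TR -> R.

Definition int_on a := mu.-integrable D (EFin \o a).

Definition real_L2 a := measurable_fun D a /\ int_on (fun t => a t ^+ 2).

Lemma int_on_dominated a b : measurable_fun D a -> int_on b ->
  (forall t, D t -> `|a t| <= b t) -> int_on a.
Proof.
move=> ma ib ab; apply: (le_integrable mD _ _ ib).
  exact/measurable_EFinP.
by move=> t Dt /=; rewrite lee_fin (le_trans (ab t Dt))// ler_norm.
Qed.

Lemma int_onD a b : int_on a -> int_on b -> int_on (fun t => a t + b t).
Proof. by move=> ia ib; have := integrableD mD ia ib. Qed.

Lemma int_onZ c a : int_on a -> int_on (fun t => c * a t).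
Proof. by move=> ia; have := integrableZl mD c ia. Qed.

Lemma int_onN a : int_on a -> int_on (fun t => - a t).
Proof.
move=> /(int_onZ (-1)); rewrite /int_on.
by under eq_fun => t do rewrite /= mulN1r.
Qed.

Lemma int_onB a b : int_on a -> int_on b -> int_on (fun t => a t - b t).
Proof. by move=> ia ib; exact/(int_onD ia)/int_onN. Qed.

Lemma int_on_measurable a : int_on a -> measurable_fun D a.
Proof. by move=> /integrableP[/measurable_EFinP]. Qed.

Lemma real_L2_mul a b : real_L2 a -> real_L2 b -> int_on (fun t => a t * b t).
Proof.
move=> [ma ia] [mb ib]; apply: (int_on_dominated _ (int_onD ia ib)).
  exact: measurable_funM.
move=> t _; rewrite normrM -[a t ^+ 2]real_normK ?num_real// -[b t ^+ 2]real_normK ?num_real//.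
by have := sqr_ge0 (`|a t| - `|b t|); have := normr_ge0 (a t); have := normr_ge0 (b t); nra.
Qed.

Lemma real_L2D a b : real_L2 a -> real_L2 b -> real_L2 (fun t => a t + b t).
Proof.
move=> [ma ia] [mb ib]; split; first exact: measurable_funD.
apply: (int_on_dominated _ (int_onZ 2 (int_onD ia ib))).
  by apply: measurable_funX; exact: measurable_funD.
move=> t _; rewrite ger0_norm ?sqr_ge0//.
by have := sqr_ge0 (a t - b t); nra.
Qed.

Lemma real_L2Z c a : real_L2 a -> real_L2 (fun t => c * a t).
Proof.
move=> [ma ia]; split; first exact: measurable_funM.
by have := int_onZ (c ^+ 2) ia; rewrite /int_on; under eq_fun => t do rewrite -exprMn.
Qed.

Lemma real_L2N a : real_L2 a -> real_L2 (fun t => - a t).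
Proof.
by move=> /(real_L2Z (-1)); under eq_fun => t do rewrite mulN1r.
Qed.

Lemma real_L2B a b : real_L2 a -> real_L2 b -> real_L2 (fun t => a t - b t).
Proof. by move=> La Lb; exact/(real_L2D La)/real_L2N. Qed.

Lemma int_on_ge0P a : measurable_fun D a -> (forall t, D t -> 0 <= a t) ->
  int_on a <-> (\int[mu]_(t in D) (a t)%:E < +oo)%E.
Proof.
move=> ma a0.
have E : (\int[mu]_(t in D) `|(EFin \o a) t| = \int[mu]_(t in D) (a t)%:E)%E.
  by apply: eq_integral => t /set_mem Dt /=; rewrite ger0_norm// a0.
split=> [/integrableP[_]|ai]; first by rewrite E.
by apply/integrableP; split; [exact/measurable_EFinP|rewrite E].
Qed.

Lemma int_onE a : int_on a -> (\int[mu]_(t in D) (a t)%:E)%E = (\int[mu]_(t in D) a t)%:E.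
Proof. by move=> /(integrable_fin_num mD) H; rewrite fineK. Qed.

Section RieszFischer.
Variable (u : nat -> TR -> R) (C : R).
Hypotheses (uL2 : forall n, real_L2 (u n)).
Hypothesis uS : forall n, \int[mu]_(t in D) ((u n.+1 t - u n t) ^+ 2) <= C * 50 ^- n.

(** If int (u_(k+1) - u_k)^2 <= C 50^-k, then G = sum 25^k (u_(k+1) - u_k)^2 has
    integral at most C sum 2^-k = 2 C and is finite almost everywhere.  Where G is
    finite, |u_(k+1) - u_k| <= sqrt G 5^-k, so u_n converges pointwise, and the
    squared distance to the limit is at most (5/4)^2 25^-n G; integrating gives
    convergence in L2. *)
Definition rf_term k (t : TR) : \bar R := (25 ^+ k * (u k.+1 t - u k t) ^+ 2)%:E.
Definition rf_dom (t : TR) : \bar R := (\sum_(0 <= k <oo) rf_term k t)%E.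

Lemma rf_int k : int_on (fun t => (u k.+1 t - u k t) ^+ 2).
Proof. by case: (real_L2B (uL2 k.+1) (uL2 k)). Qed.

Lemma rf_term_int k : int_on (fun t => 25 ^+ k * (u k.+1 t - u k t) ^+ 2).
Proof. exact/int_onZ/rf_int. Qed.

Lemma rf_term_ge0 k t : (0 <= rf_term k t)%E.
Proof. by rewrite /rf_term lee_fin mulr_ge0 ?sqr_ge0 ?exprn_ge0. Qed.

Lemma rf_dom_ge0 t : (0 <= rf_dom t)%E.
Proof. by apply: nneseries_ge0 => n _ _; exact: rf_term_ge0. Qed.

Lemma rf_term_measurable k : measurable_fun D (rf_term k).
Proof. by have /int_on_measurable/measurable_EFinP := rf_term_int k. Qed.

Lemma rf_dom_measurable : measurable_fun D rf_dom.
Proof.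
apply: ge0_emeasurable_sum => [k t _ _|k _]; first exact: rf_term_ge0.
exact: rf_term_measurable.
Qed.

Lemma rf_C_ge0 : 0 <= C.
Proof.
have := uS 0; rewrite expr0 invr1 mulr1; apply: le_trans.
by apply: Rintegral_ge0 => t _; rewrite sqr_ge0.
Qed.

Lemma rf_dom_int : (\int[mu]_(t in D) rf_dom t <= (2 * C)%:E)%E.
Proof.
rewrite /rf_dom integral_nneseries//; last 2 first.
  exact: rf_term_measurable.
  by move=> n t _; exact: rf_term_ge0.
apply: lime_le.
  by apply: is_cvg_nneseries => k _ _; apply: integral_ge0 => t _; exact: rf_term_ge0.
apply: nearW => n.
suff : (\sum_(0 <= k < n) \int[mu]_(t in D) rf_term k t <= (2 * C * (1 - 2 ^- n))%:E)%E.
  move/le_trans; apply; rewrite lee_fin ler_piMr ?mulr_ge0 ?rf_C_ge0//.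
elim: n => [|n IH]; first by rewrite big_nil expr0 invr1 subrr mulr0.
rewrite big_nat_recr//=.
have H : (\int[mu]_(t in D) rf_term n t <= (C * 2 ^- n)%:E)%E.
  rewrite /rf_term int_onE; last exact: rf_term_int.
  rewrite lee_fin RintegralZl//; last exact: rf_int.
  rewrite (le_trans (ler_wpM2l _ (uS n))) ?exprn_ge0//.
  suff -> : 25 ^+ n * (C * 50 ^- n) = C * 2 ^- n :> R by [].
  have -> : 50 ^+ n = 25 ^+ n * 2 ^+ n :> R by rewrite -exprMn -natrM.
  by field; rewrite !expf_neq0// pnatr_eq0.
rewrite (le_trans (leeD IH H))// -EFinD lee_fin.
suff -> : 2 * C * (1 - 2 ^- n) + C * 2 ^- n = 2 * C * (1 - 2 ^- n.+1) by [].
by rewrite exprS; field; rewrite !expf_neq0// pnatr_eq0.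
Qed.

(** The upper limit makes [rf_lim] measurable everywhere, also at the points where
    [u n t] diverges. *)
Definition rf_lim (t : TR) : R := fine (limn_esup (fun n => (u n t)%:E)).

Lemma rf_lim_bound t n : rf_dom t \is a fin_num ->
  (((u n t - rf_lim t) ^+ 2)%:E <= (25 / 16 * 25 ^- n)%:E * rf_dom t)%E.
Proof.
move=> Ft; set G := fine (rf_dom t).
have GE : rf_dom t = G%:E by rewrite /G fineK.
have G0 : 0 <= G by rewrite -lee_fin -GE rf_dom_ge0.
have d25 k : 25 ^+ k * (u k.+1 t - u k t) ^+ 2 <= G.
  rewrite -lee_fin -GE -/(rf_term k t).
  have := @nneseries_lim_ge R (rf_term^~ t) xpredT 0 k.+1 (fun n _ _ => rf_term_ge0 n t).
  apply: le_trans; rewrite big_nat_recr//= leeDr// sume_ge0// => j _.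
  exact: rf_term_ge0.
pose s := Num.sqrt G.
have sG : s ^+ 2 = G by rewrite sqr_sqrtr.
have d5 k : `|u k.+1 t - u k t| <= s * 5 ^- k.
  rewrite -(@ler_pXn2r _ 2)// ?nnegrE ?mulr_ge0 ?invr_ge0 ?exprn_ge0 ?sqrtr_ge0//.
  rewrite real_normK ?num_real// exprMn sG -ler_pdivrMr; last first.
    by rewrite exprn_gt0// invr_gt0 exprn_gt0.
  rewrite exprVn invrK -exprM mulnC exprM mulrC.
  by have -> : 5 ^+ 2 = 25 :> R by rewrite -natrX.
have [l ul lP] := @geometric_cvg R R (u^~ t) s (fun e e0 => geometric_small s e0) d5.
have -> : rf_lim t = l.
  rewrite /rf_lim; suff -> : limn_esup (fun n => (u n t)%:E) = l%:E by [].
  apply: (@cvg_limn_einf_sup R _ l%:E _).2.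
  by apply: cvg_EFin; [exact: nearW|exact: ul].
rewrite GE -EFinM lee_fin -sG.
have -> : 25 / 16 * 25 ^- n * s ^+ 2 = (s * (5 / 4) * 5 ^- n) ^+ 2.
  have -> : 25 = 5 ^+ 2 :> R by rewrite -natrX.
  rewrite -exprM mulnC exprM; field; rewrite ?expf_neq0// pnatr_eq0.
rewrite -[_ ^+ 2]real_normK ?num_real// distrC.
by rewrite ler_pXn2r ?nnegrE ?mulr_ge0 ?invr_ge0 ?exprn_ge0 ?sqrtr_ge0.
Qed.

Lemma rf_lim_measurable : measurable_fun D rf_lim.
Proof.
apply: (measurableT_comp (fine_measurable measurableT)).
apply: measurable_fun_limn_esup => n; apply/measurable_EFinP.
by case: (uL2 n).
Qed.

Lemma rf_lim_int n :
  (\int[mu]_(t in D) ((u n t - rf_lim t) ^+ 2)%:E <= (25 / 16 * 25 ^- n * (2 * C))%:E)%E.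
Proof.
have c0 : 0 <= 25 / 16 * 25 ^- n :> R by rewrite !mulr_ge0// invr_ge0 exprn_ge0.
have m1 : measurable_fun D (fun t => ((u n t - rf_lim t) ^+ 2)%:E).
  apply/measurable_EFinP; apply: measurable_funX; apply: measurable_funB.
    by case: (uL2 n).
  exact: rf_lim_measurable.
apply: (@le_trans _ _ (\int[mu]_(t in D) ((25 / 16 * 25 ^- n)%:E * rf_dom t))%E).
  apply: ae_ge0_le_integral => //.
  - by move=> t _; rewrite lee_fin sqr_ge0.
  - by move=> t _; rewrite mule_ge0// rf_dom_ge0.
  - by apply: measurable_funeM; exact: rf_dom_measurable.
  have : mu.-integrable D rf_dom.
    apply/integrableP; split; first exact: rf_dom_measurable.
    under eq_integral => t _ do rewrite gee0_abs ?rf_dom_ge0//.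
    by rewrite (le_lt_trans rf_dom_int)// ltry.
  move=> /(integrable_ae mD); apply: filterS => t tF Dt.
  exact/rf_lim_bound/tF.
rewrite ge0_integralZl_EFin//; last 2 first.
  by move=> t _; exact: rf_dom_ge0.
  exact: rf_dom_measurable.
by rewrite [leRHS]EFinM lee_wpmul2l ?lee_fin// rf_dom_int.
Qed.

Lemma riesz_fischer : exists2 v : TR -> R, real_L2 v & exists C', forall n,
  \int[mu]_(t in D) ((u n t - v t) ^+ 2) <= C' * 25 ^- n.
Proof.
have m1 n : measurable_fun D (fun t => u n t - rf_lim t).
  by apply: measurable_funB; [case: (uL2 n)|exact: rf_lim_measurable].
have i1 n : int_on (fun t => (u n t - rf_lim t) ^+ 2).
  apply/int_on_ge0P => //.
  - exact: measurable_funX.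
  - by move=> t _; exact: sqr_ge0.
  - by rewrite (le_lt_trans (rf_lim_int n))// ltry.
exists rf_lim.
  have := real_L2B (uL2 0) (conj (m1 0) (i1 0)).
  by under eq_fun => t do rewrite subKr.
exists (25 / 16 * (2 * C)) => n.
rewrite -lee_fin -int_onE// (le_trans (rf_lim_int n))// lee_fin.
by rewrite mulrAC.
Qed.

End RieszFischer.
End RealL2.

(** * The complex space L2 *)

Section ComplexL2.
Context {R : realType}.
Local Notation mu := (@lebesgue_measure R).
Local Notation TR := (measurableTypeR R).
Variable D : set TR.
Hypothesis mD : measurable D.
Implicit Types (u v w : TR -> R[i]) (c : R[i]).

Lemma ReM (a b : R[i]) : Re (a * b) = Re a * Re b - Im a * Im b.
Proof. by case: a b => ? ? []. Qed.
Lemma ImM (a b : R[i]) : Im (a * b) = Re a * Im b + Im a * Re b.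
Proof. by case: a b => ? ? []. Qed.
Lemma ReD (a b : R[i]) : Re (a + b) = Re a + Re b.
Proof. by case: a b => ? ? []. Qed.
Lemma ImD (a b : R[i]) : Im (a + b) = Im a + Im b.
Proof. by case: a b => ? ? []. Qed.
Lemma ReN (a : R[i]) : Re (- a) = - Re a.
Proof. by case: a. Qed.
Lemma ImN (a : R[i]) : Im (- a) = - Im a.
Proof. by case: a. Qed.
Lemma ReJ (a : R[i]) : Re (Num.conj a) = Re a.
Proof. by case: a. Qed.
Lemma ImJ (a : R[i]) : Im (Num.conj a) = - Im a.
Proof. by case: a. Qed.
Lemma complexP (a b : R[i]) : Re a = Re b -> Im a = Im b -> a = b.
Proof. by case: a b => ? ? [? ?] /= -> ->. Qed.

Definition cint_on u := int_on D (fun t => Re (u t)) /\ int_on D (fun t => Im (u t)).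
Local Notation cint := (@complex_integral R D).

Lemma eq_cint u v : (forall t, D t -> u t = v t) -> cint u = cint v.
Proof.
move=> uv; congr (_ +i* _); apply: eq_Rintegral => t /set_mem Dt; by rewrite uv.
Qed.

Lemma cint_onD u v : cint_on u -> cint_on v -> cint_on (fun t => u t + v t).
Proof.
move=> [ru iu] [rv iv]; split.
  by under eq_fun => t do rewrite ReD; exact: int_onD.
by under eq_fun => t do rewrite ImD; exact: int_onD.
Qed.

Lemma cintD u v : cint_on u -> cint_on v -> cint (fun t => u t + v t) = cint u + cint v.
Proof.
move=> [ru iu] [rv iv]; apply: complexP; rewrite /= -RintegralD//;
  by apply: eq_Rintegral => t _; rewrite ?ReD ?ImD.
Qed.

Lemma cint_onZ c u : cint_on u -> cint_on (fun t => c * u t).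
Proof.
move=> [ru iu]; split.
  by under eq_fun => t do rewrite ReM; apply: int_onB => //; exact: int_onZ.
by under eq_fun => t do rewrite ImM; apply: int_onD => //; exact: int_onZ.
Qed.

Lemma cintZ c u : cint_on u -> cint (fun t => c * u t) = c * cint u.
Proof.
move=> [ru iu]; apply: complexP.
  rewrite ReM/= -!RintegralZl// -RintegralB//; try exact: int_onZ.
  by apply: eq_Rintegral => t _; rewrite ReM.
rewrite ImM/= -!RintegralZl// -RintegralD//; try exact: int_onZ.
by apply: eq_Rintegral => t _; rewrite ImM.
Qed.

Lemma cint_conj u : cint_on u -> cint (fun t => Num.conj (u t)) = Num.conj (cint u).
Proof.
move=> [ru iu]; apply: complexP; rewrite ?ReJ ?ImJ/=.
  by apply: eq_Rintegral => t _; rewrite ReJ.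
rewrite -[RHS]mulN1r -RintegralZl//.
by apply: eq_Rintegral => t _; rewrite ImJ mulN1r.
Qed.

Definition cL2 u := real_L2 D (fun t => Re (u t)) /\ real_L2 D (fun t => Im (u t)).
Local Notation ip := (@L2_product R D).

Lemma square_integrableP u : square_integrable D u <-> cL2 u.
Proof.
split=> [[mr mi fi]|[[mr ir] [mi ii]]].
  have io : int_on D (fun t => Re (u t) ^+ 2 + Im (u t) ^+ 2).
    apply/int_on_ge0P => //.
      by apply: measurable_funD; exact: measurable_funX.
    by move=> t _; rewrite addr_ge0 ?sqr_ge0.
  split; split => //; apply: (int_on_dominated mD _ io).
  - exact: measurable_funX.
  - by move=> t _; rewrite ger0_norm ?sqr_ge0// lerDl sqr_ge0.
  - exact: measurable_funX.
  - by move=> t _; rewrite ger0_norm ?sqr_ge0// lerDr sqr_ge0.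
split => //; have io := int_onD mD ir ii.
apply/(int_on_ge0P _ _).1 => //.
- exact: int_on_measurable io.
- by move=> t _; rewrite addr_ge0 ?sqr_ge0.
Qed.

Lemma cL2D u v : cL2 u -> cL2 v -> cL2 (fun t => u t + v t).
Proof.
move=> [ru iu] [rv iv]; split.
  by under eq_fun => t do rewrite ReD; exact: real_L2D.
by under eq_fun => t do rewrite ImD; exact: real_L2D.
Qed.

Lemma cL2Z c u : cL2 u -> cL2 (fun t => c * u t).
Proof.
move=> [ru iu]; split.
  by under eq_fun => t do rewrite ReM; apply: real_L2B => //; exact: real_L2Z.
by under eq_fun => t do rewrite ImM; apply: real_L2D => //; exact: real_L2Z.
Qed.

Lemma cL2_conj u : cL2 u -> cL2 (fun t => Num.conj (u t)).
Proof.
move=> [ru iu]; split.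
  by under eq_fun => t do rewrite ReJ.
by under eq_fun => t do rewrite ImJ; exact: real_L2N.
Qed.

Lemma cL2_mul u v : cL2 u -> cL2 v -> cint_on (fun t => u t * v t).
Proof.
move=> [ru iu] [rv iv]; split.
  by under eq_fun => t do rewrite ReM; apply: int_onB => //; exact: real_L2_mul.
by under eq_fun => t do rewrite ImM; apply: int_onD => //; exact: real_L2_mul.
Qed.

Lemma cL2_int u v : cL2 u -> cL2 v -> cint_on (fun t => u t * Num.conj (v t)).
Proof. by move=> Lu Lv; exact/cL2_mul/cL2_conj. Qed.

Lemma L2_ipDl u v w : cL2 u -> cL2 v -> cL2 w ->
  ip (fun t => u t + v t) w = ip u w + ip v w.
Proof.
move=> Lu Lv Lw; rewrite /L2_product -cintD; try exact: cL2_int.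
by apply: eq_cint => t _; rewrite mulrDl.
Qed.

Lemma L2_ipZl c u w : cL2 u -> cL2 w -> ip (fun t => c * u t) w = c * ip u w.
Proof.
move=> Lu Lw; rewrite /L2_product -cintZ; last exact: cL2_int.
by apply: eq_cint => t _; rewrite mulrA.
Qed.

Lemma L2_ipC u v : cL2 u -> cL2 v -> ip u v = Num.conj (ip v u).
Proof.
move=> Lu Lv; rewrite /L2_product -cint_conj; last exact: cL2_int.
by apply: eq_cint => t _; rewrite rmorphM/= [Num.conj (Num.conj _)]conjCK mulrC.
Qed.

Lemma L2_ipDr u v w : cL2 u -> cL2 v -> cL2 w ->
  ip w (fun t => u t + v t) = ip w u + ip w v.
Proof.
move=> Lu Lv Lw; rewrite L2_ipC//; last exact: cL2D.
by rewrite L2_ipDl// rmorphD/= -!L2_ipC.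
Qed.

Lemma L2_ipZr c u w : cL2 u -> cL2 w -> ip w (fun t => c * u t) = Num.conj c * ip w u.
Proof.
move=> Lu Lw; rewrite L2_ipC//; last exact: cL2Z.
by rewrite L2_ipZl// rmorphM/= -L2_ipC.
Qed.

Definition L2_norm2 u : R := \int[mu]_(t in D) (Re (u t) ^+ 2 + Im (u t) ^+ 2).

Lemma L2_norm2_ge0 u : 0 <= L2_norm2 u.
Proof. by apply: Rintegral_ge0 => t _; rewrite addr_ge0 ?sqr_ge0. Qed.

Lemma L2_ip_norm2 u : ip u u = (L2_norm2 u)%:C.
Proof.
apply: complexP => /=.
  by apply: eq_Rintegral => t _; rewrite ReM ReJ ImJ; ring.
rewrite (_ : (fun t => _) = cst 0); last by apply/funext => t; rewrite ImM ReJ ImJ/=; ring.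
by rewrite Rintegral_cst// mul0r.
Qed.

Lemma L2_norm2Z c u : cL2 u -> L2_norm2 (fun t => c * u t) = nrm c ^+ 2 * L2_norm2 u.
Proof.
move=> Lu; apply: (@complexI R); rewrite -L2_ip_norm2 L2_ipZl//; last exact: cL2Z.
rewrite L2_ipZr// mulrA -normCK nrmE L2_ip_norm2.
by rewrite -(rmorphXn (real_complex R)) -(rmorphM (real_complex R)).
Qed.

Lemma L2_norm2D u v s : cL2 u -> cL2 v ->
  L2_norm2 (fun t => u t + s * v t) =
  L2_norm2 u + nrm s ^+ 2 * L2_norm2 v + 2 * Re (s * ip v u).
Proof.
move=> Lu Lv; have Lsv := cL2Z s Lv.
apply: (@complexI R); rewrite -L2_ip_norm2 L2_ipDl//; last exact: cL2D.
rewrite !L2_ipDr// L2_ipZr// [ip u v]L2_ipC// !L2_ipZl// L2_ipZr// !L2_ip_norm2.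
rewrite mulrA -normCK nrmE -(rmorphXn (real_complex R)) -(rmorphM (real_complex R)).
have -> : Num.conj s * Num.conj (ip v u) = Num.conj (s * ip v u) by rewrite rmorphM.
set d := s * ip v u.
by apply: complexP; rewrite !(ReD, ImD)/= ?ReJ ?ImJ/=; ring.
Qed.

End ComplexL2.

(** The argument behind the Cauchy-Schwarz inequality: take
    s = - conj d / (1 + q).  The denominator 1 + q instead of the optimal q avoids
    the case q = 0, and costs only a larger constant. *)
Lemma quadratic_nonneg_bound {R : realType} (e q : R) (d : R[i]) : 0 <= q ->
  (forall s : R[i], 0 <= e + nrm s ^+ 2 * q + 2 * Re (s * d)) ->
  nrm d ^+ 2 <= (1 + q) * e.
Proof.
move=> q0 H; have q1 : 0 < 1 + q by rewrite ltr_wpDr.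
have := H (- ((1 + q)^-1)%:C * Num.conj d).
rewrite nrmM nrmN nrm_real nrm_conj ger0_norm ?invr_ge0 ?(ltW q1)//.
have -> : Re (- ((1 + q)^-1)%:C * Num.conj d * d) = - ((1 + q)^-1 * nrm d ^+ 2).
  by rewrite -mulrA ReM ReN ImN nrm_sqr ReM ImM ReJ ImJ/=; ring.
set N := nrm d ^+ 2.
have N0 : 0 <= N by rewrite exprn_ge0 ?nrm_ge0.
rewrite exprMn -/N => H1.
rewrite mulrC -ler_pdivrMr//.
have : (1 + q)^-1 ^+ 2 * N * q <= (1 + q)^-1 * N.
  rewrite (_ : _ * q = (1 + q)^-1 * N * ((1 + q)^-1 * q)); last by ring.
  apply: ler_piMr; first by apply: mulr_ge0 => //; rewrite invr_ge0 ltW.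
  by rewrite ler_pdivrMl// mulr1 lerDr.
by rewrite [N / _]mulrC; lra.
Qed.

(** * The moment problem *)

Section MomentProblem.
Context {R : realType}.
Local Notation mu := (@lebesgue_measure R).
Local Notation TR := (measurableTypeR R).
Variable D : set TR.
Hypothesis mD : measurable D.
Local Notation ip := (@L2_product R D).
Local Notation N2 := (@L2_norm2 R D).

(** The constant is not the sharp one of the Cauchy-Schwarz inequality; all uses
    need only a bound that is linear in [N2 u]. *)
Lemma L2_weak_bound u v : cL2 D u -> cL2 D v ->
  nrm (ip v u) ^+ 2 <= (1 + N2 v) * N2 u.
Proof.
move=> Lu Lv; apply: quadratic_nonneg_bound; first exact: L2_norm2_ge0.
by move=> s; rewrite -L2_norm2D//; exact: L2_norm2_ge0.
Qed.

Lemma cL2_0 : cL2 D (fun=> 0).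
Proof.
have z : real_L2 D (fun=> 0 : R).
  split => //; rewrite /int_on (_ : EFin \o _ = cst 0%E); first exact: integrable0.
  by apply/funext => t /=; rewrite expr0n.
by split.
Qed.

Lemma cL2_sum n (F : nat -> TR -> R[i]) : (forall j, cL2 D (F j)) ->
  cL2 D (fun t => \sum_(j < n) F j t).
Proof.
move=> LF; elim: n => [|n IH].
  by under eq_fun => t do rewrite big_ord0; exact: cL2_0.
by under eq_fun => t do rewrite big_ord_recr/=; exact: cL2D.
Qed.

Lemma L2_ip_suml n (F : nat -> TR -> R[i]) w : (forall j, cL2 D (F j)) -> cL2 D w ->
  ip (fun t => \sum_(j < n) F j t) w = \sum_(j < n) ip (F j) w.
Proof.
move=> LF Lw; elim: n => [|n IH].
  rewrite big_ord0; under eq_fun => t do rewrite big_ord0.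
  transitivity (ip (fun=> 0 * 0) w); last by rewrite L2_ipZl ?mul0r//; exact: cL2_0.
  by congr (L2_product _ _ _); apply/funext => t; rewrite mul0r.
rewrite big_ord_recr/= -IH -L2_ipDl//; last exact: cL2_sum.
by congr (L2_product _ _ _); apply/funext => t; rewrite big_ord_recr.
Qed.

Lemma complex_riesz_fischer (g : nat -> TR -> R[i]) (C : R) :
  (forall n, cL2 D (g n)) ->
  (forall n, N2 (fun t => g n.+1 t - g n t) <= C * 50 ^- n) ->
  exists2 h, cL2 D h & exists C', forall n, N2 (fun t => g n t - h t) <= C' * 25 ^- n.
Proof.
move=> gL gS.
have sqD u v : cL2 D u -> cL2 D v -> let w t := u t - v t in
    int_on D (fun t => (Re (u t) - Re (v t)) ^+ 2) /\
    int_on D (fun t => (Im (u t) - Im (v t)) ^+ 2).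
  move=> [ru iu] [rv iv] w; split.
    by case: (real_L2B mD ru rv).
  by case: (real_L2B mD iu iv).
have NE u v : cL2 D u -> cL2 D v -> N2 (fun t => u t - v t) =
    \int[mu]_(t in D) ((Re (u t) - Re (v t)) ^+ 2) +
    \int[mu]_(t in D) ((Im (u t) - Im (v t)) ^+ 2).
  move=> Lu Lv; have [i1 i2] := sqD _ _ Lu Lv.
  rewrite -RintegralD//; apply: eq_Rintegral => t _.
  by rewrite ReD ImD ReN ImN.
have ge0 (u : TR -> R) : 0 <= \int[mu]_(t in D) (u t ^+ 2).
  by apply: Rintegral_ge0 => t _; exact: sqr_ge0.
have [|n|vr Lr [Cr vrP]] := @riesz_fischer R D mD (fun n t => Re (g n t)) C.
- by move=> n; case: (gL n).
- by rewrite (le_trans _ (gS n))// NE// lerDl.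
have [|n|vi Li [Ci viP]] := @riesz_fischer R D mD (fun n t => Im (g n t)) C.
- by move=> n; case: (gL n).
- by rewrite (le_trans _ (gS n))// NE// lerDr.
have Lh : cL2 D (fun t => vr t +i* vi t) by split.
exists (fun t => vr t +i* vi t) => //; exists (Cr + Ci) => n.
by rewrite NE// mulrDl lerD.
Qed.

Lemma geometric_le0 (r K : R) : (forall n, r <= K * 25 ^- n) -> r <= 0.
Proof.
move=> H; apply/ler_addgt0Pr => e e0; rewrite add0r.
have [N _ /(_ N (leqnn N)) NP] := geometric_small `|K| e0.
rewrite (le_trans (H N))// (le_trans _ (ltW NP))//.
rewrite (le_trans (ler_wpM2r _ (ler_norm K))) ?invr_ge0 ?exprn_ge0//.
rewrite -mulrA ler_wpM2l//.
apply: (@le_trans _ _ (5 ^- N)).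
  by rewrite lef_pV2 ?posrE ?exprn_gt0// lerXn2r ?nnegrE// ler_nat.
by rewrite ler_peMl ?invr_ge0 ?exprn_ge0// ler_pdivlMr// mul1r ler_nat.
Qed.

Variables (f : nat -> TR -> R[i]) (c : nat -> R[i]) (C : R).
Hypothesis fL2 : forall j, cL2 D (f j).
Hypothesis C_ge0 : 0 <= C.
Hypothesis cC : forall n (a : nat -> R[i]), nrm (\sum_(j < n) a j * c j) ^+ 2 <=
  C * N2 (fun t => \sum_(j < n) a j * f j t).

(** The graph of the functional that maps f_j to c_j, on the span of the f_j.
    Working with pairs (g, l) avoids choosing coefficients for g; by the bound
    [cC] the value l depends on g only. *)
Definition moment_span (g : TR -> R[i]) (l : R[i]) := exists n (a : nat -> R[i]),
  g = (fun t => \sum_(j < n) a j * f j t) /\ l = \sum_(j < n) a j * c j.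

Lemma moment_span_gen j : moment_span (f j) (c j).
Proof.
have E (x : nat -> R[i]) : x j = \sum_(i < j.+1) (i == j :> nat)%:R * x i.
  rewrite big_ord_recr/= eqxx mul1r big1 ?add0r// => i _.
  by rewrite ltn_eqF// mul0r.
exists j.+1, (fun i => (i == j)%:R); split; last exact: E.
by apply/funext => t; rewrite (E (f^~ t)).
Qed.

Lemma moment_span_comb s g l k m : moment_span g l -> moment_span k m ->
  moment_span (fun t => g t + s * k t) (l + s * m).
Proof.
move=> [n [a [-> ->]]] [n' [a' [-> ->]]].
have E (x : nat -> R[i]) : \sum_(j < n) a j * x j + s * (\sum_(j < n') a' j * x j) =
    \sum_(j < maxn n n') ((if (j < n)%N then a j else 0) +
      s * (if (j < n')%N then a' j else 0)) * x j.
  rewrite mulr_sumr.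
  rewrite (big_ord_widen _ (fun j => a j * x j) (leq_maxl n n')).
  rewrite (big_ord_widen _ (fun j => s * (a' j * x j)) (leq_maxr n n')).
  rewrite big_mkcond [X in _ + X]big_mkcond -big_split/=.
  apply: eq_bigr => j _; rewrite mulrDl -!mulrA.
  by case: ifP => _; case: ifP => _; rewrite ?mul0r ?mulr0.
exists (maxn n n'), (fun j => (if (j < n)%N then a j else 0) +
      s * (if (j < n')%N then a' j else 0)); split; last exact: E.
by apply/funext => t; rewrite (E (f^~ t)).
Qed.

Lemma moment_span_L2 g l : moment_span g l -> cL2 D g.
Proof.
move=> [n [a [-> _]]].
by apply: (@cL2_sum n (fun j t => a j * f j t)) => j; exact: cL2Z.
Qed.

(** Its minimizers on the closure of the span represent the functional: where the
    energy is stationary, the inner product with g equals the functional. *)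
Definition energy (g : TR -> R[i]) (l : R[i]) : R := N2 g - 2 * Re l.

Lemma energyD s g l k m : cL2 D g -> cL2 D k ->
  energy (fun t => g t + s * k t) (l + s * m) =
  energy g l + nrm s ^+ 2 * N2 k + 2 * Re (s * (ip k g - m)).
Proof.
move=> Lg Lk; rewrite /energy L2_norm2D// ReD mulrBr ReD ReN; ring.
Qed.

(** Since |l|^2 <= C |g|^2, the energy is at least |g|^2 - 2 sqrt C |g| >= - C. *)
Lemma energy_ge g l : moment_span g l -> - C <= energy g l.
Proof.
move=> [n [a [-> ->]]]; rewrite /energy.
have := cC n a; set q := N2 _; set l' := \sum_(_ < _) _ => H.
have q0 : 0 <= q by exact: L2_norm2_ge0.
have H1 : Re l' ^+ 2 <= C * q.
  by rewrite (le_trans _ H)// nrm_sqr lerDl sqr_ge0.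
rewrite leNgt; apply/negP; set r := Re l' in H1 *; move: C_ge0 => C0 H2.
have H3 : 0 <= q + C by rewrite addr_ge0.
have H4 : q + C < 2 * r by lra.
have : (q + C) ^+ 2 < (2 * r) ^+ 2.
  by rewrite ltr_pXn2r// nnegrE// (le_trans H3)// ltW.
by have := sqr_ge0 (q - C); nra.
Qed.

(** Let (g_n, l_n) have energy within 50^-n of the infimum m.  The midpoint of two
    consecutive pairs has energy at least m, which by the parallelogram identity
    forces |g_(n+1) - g_n|^2 <= 4 50^-n, so g_n converges to some h.  Since energies
    along g_n + s f_j are at least m for all s, (f_j, g_n) - c_j is at most of order
    50^(-n/2), and it vanishes in the limit. *)
Theorem moment_problem : exists2 h, cL2 D h & forall j, ip (f j) h = c j.
Proof.
pose E := [set r | exists g l, moment_span g l /\ r = energy g l].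
have infE : has_inf E.
  split.
    by exists (energy (f 0%N) (c 0%N)), (f 0%N), (c 0%N); split => //; exact: moment_span_gen.
  by exists (- C) => _ [g [l [gl ->]]]; exact: energy_ge.
pose m := inf E.
have mE g l : moment_span g l -> m <= energy g l.
  by move=> gl; apply: ge_inf; [case: infE|exists g, l].
have eps_gt0 n : 0 < 50 ^- n :> R by rewrite invr_gt0 exprn_gt0.
have seq n : {gl : (TR -> R[i]) * R[i] | moment_span gl.1 gl.2 /\
    energy gl.1 gl.2 < m + 50 ^- n}.
  apply: cid; have [_ [g [l [gl ->]]] H] := inf_adherent (eps_gt0 n) infE.
  by exists (g, l).
pose g n := (sval (seq n)).1; pose l n := (sval (seq n)).2.
have gl n : moment_span (g n) (l n) by case: (svalP (seq n)).
have ge n : energy (g n) (l n) < m + 50 ^- n by case: (svalP (seq n)).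
have gL n : cL2 D (g n) := moment_span_L2 (gl n).
have gS n : N2 (fun t => g n.+1 t - g n t) <= 4 * 50 ^- n.
  set k := fun t => g n.+1 t - g n t; pose lk := l n.+1 - l n.
  have ks : moment_span k lk.
    have := moment_span_comb (-1) (gl n.+1) (gl n).
    by rewrite mulN1r; congr moment_span; apply/funext => t; rewrite mulN1r.
  have kL := moment_span_L2 ks.
  have E1 : energy (g n.+1) (l n.+1) =
      energy (g n) (l n) + N2 k + 2 * Re (ip k (g n) - lk).
    have := energyD 1 (l n) lk (gL n) kL.
    rewrite !mul1r {2}/lk [l n + _]addrC subrK (nrm_real 1) normr1 expr1n mul1r => <-.
    by congr energy; apply/funext => t; rewrite mul1r /k [g n t + _]addrC subrK.
  (* The energy at the midpoint of the two pairs. *)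
  have E2 : m <= energy (g n) (l n) + N2 k / 4 + Re (ip k (g n) - lk).
    have := mE _ _ (moment_span_comb (2^-1)%:C (gl n) ks).
    rewrite energyD// nrm_real ger0_norm// ReM/= mul0r subr0.
    by set e := energy _ _; set q := N2 k; set r := Re _; lra.
  have h1 := ge n; have h2 := ge n.+1.
  have h3 : 50 ^- n.+1 <= 50 ^- n :> R.
    by rewrite lef_pV2 ?posrE ?exprn_gt0// ler_eXn2l// ltr1n.
  move: E1 E2 h1 h2 h3; set e1 := energy _ _; set e2 := energy _ _.
  by set q := N2 k; set r := Re _; set x := 50 ^- n; set y := 50 ^- n.+1; lra.
have [h Lh [C' hP]] := complex_riesz_fischer gL gS.
exists h => // j; apply/eqP; rewrite -subr_eq0; apply/eqP/nrm_eq0/eqP.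
rewrite -sqrf_eq0 eq_le sqr_ge0 andbT.
apply: (@geometric_le0 _ (2 * (1 + N2 (f j)) * (1 + C'))) => n.
have q0 : 0 <= 1 + N2 (f j) by rewrite addr_ge0 ?L2_norm2_ge0.
have b1 : nrm (ip (f j) (g n) - c j) ^+ 2 <= (1 + N2 (f j)) * 50 ^- n.
  apply: quadratic_nonneg_bound; first exact: L2_norm2_ge0.
  move=> s; have := mE _ _ (moment_span_comb s (gl n) (moment_span_gen j)).
  rewrite energyD//; have := ge n; set e := energy _ _; set x := 50 ^- n.
  by set y := nrm s ^+ 2 * _; set z := Re _; lra.
have gh : cL2 D (fun t => g n t - h t).
  have := cL2D mD (gL n) (cL2Z mD (-1) Lh).
  by under eq_fun => t do rewrite mulN1r.
have b2 := le_trans (L2_weak_bound gh (fL2 j)) (ler_wpM2l q0 (hP n)).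
have E3 : ip (f j) h - c j = (ip (f j) (g n) - c j) - ip (f j) (fun t => g n t - h t).
  have -> : (fun t => g n t - h t) = (fun t => g n t + (-1) * h t).
    by apply/funext => t; rewrite mulN1r.
  rewrite L2_ipDr//; last exact: cL2Z.
  by rewrite L2_ipZr// rmorphN rmorph1 mulN1r; ring.
have b3 : nrm (ip (f j) h - c j) ^+ 2 <= 2 * (nrm (ip (f j) (g n) - c j) ^+ 2 +
    nrm (ip (f j) (fun t => g n t - h t)) ^+ 2).
  rewrite E3; set x := _ - c j; set y := ip _ (fun t => _).
  have := ler_nrmB x y; have := nrm_ge0 (x - y); have := nrm_ge0 x; have := nrm_ge0 y.
  set X := nrm x; set Y := nrm y; set Z := nrm _ => X0 Y0 Z0 ZXY.
  have : Z ^+ 2 <= (X + Y) ^+ 2 by rewrite ler_pXn2r ?nnegrE ?addr_ge0.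
  by have := sqr_ge0 (X - Y); nra.
have b4 : 50 ^- n <= 25 ^- n :> R.
  by rewrite lef_pV2 ?posrE ?exprn_gt0// lerXn2r ?nnegrE// ler_nat.
rewrite (le_trans b3)//.
have -> : 2 * (1 + N2 (f j)) * (1 + C') / 25 ^+ n =
    2 * ((1 + N2 (f j)) * 25 ^- n + (1 + N2 (f j)) * (C' * 25 ^- n)) by ring.
by rewrite ler_wpM2l// lerD// (le_trans b1)// ler_wpM2l.
Qed.

End MomentProblem.

(** * Functionals and Bochner integrals *)

Section BochnerPairing.
Context {R : realType}.
Local Notation mu := (@lebesgue_measure R).
Local Notation TR := (measurableTypeR R).
Variable D : set TR.
Hypothesis mD : measurable D.
Local Notation cint := (@complex_integral R D).

(** The majorant [N] is not assumed measurable; its integral is the supremum of the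
    integrals of simple functions below it.  So [r] is first set to 0 on a null set
    outside which the inequality holds, and monotonicity applied everywhere. *)
Lemma ae_le_integral_nonneg (r N : TR -> R) : measurable_fun D r ->
  (forall t, 0 <= r t) -> (forall t, 0 <= N t) ->
  {ae mu, forall t, D t -> r t <= N t} ->
  (\int[mu]_(t in D) (r t)%:E <= \int[mu]_(t in D) (N t)%:E)%E.
Proof.
move=> mr r0 N0 [B [mB B0 BP]].
pose r' t := r t * \1_(~` B) t.
have r'0 t : 0 <= r' t by rewrite mulr_ge0.
have mr' : measurable_fun D r'.
  by apply: measurable_funM => //; apply: measurable_indic; exact: measurableC.
apply: (@le_trans _ _ (\int[mu]_(t in D) (r' t)%:E)%E).
  apply: ae_ge0_le_integral => //.
  - by move=> t _; rewrite lee_fin.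
  - exact/measurable_EFinP.
  - by move=> t _; rewrite lee_fin.
  - exact/measurable_EFinP.
  exists B; split => // t /= H; apply: contrapT => Bt; apply: H => _.
  by rewrite /r' indicE mem_set// mulr1.
rewrite !ge0_integralE; try by move=> t _; rewrite lee_fin.
apply: ereal_sup_le => _ [h hf <-]; exists h => // t.
rewrite (le_trans (hf t))// /patch; case: ifPn => // /set_mem Dt.
rewrite lee_fin /r' indicE; case: (boolP (t \in _)) => [|_]; last by rewrite mulr0.
move=> /set_mem Bt; rewrite mulr1; apply: contrapT => H; apply: Bt; apply: BP => /=.
by move=> H'; apply: H; exact: H'.
Qed.

Context {V : completeNormedModType R[i]}.
Variables (ell : V -> R[i]) (K : R).
Hypothesis ellP : forall a x y, ell (a *: x + y) = a * ell x + ell y.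
Hypothesis ellK : forall x, nrm (ell x) <= K * nrm x.

Lemma functional0 : ell 0 = 0.
Proof.
by have := ellP (-1) 0 0; rewrite scaler0 addr0 mulN1r addNr.
Qed.

Lemma functionalB x y : ell (x - y) = ell x - ell y.
Proof.
by rewrite addrC -scaleN1r ellP mulN1r addrC.
Qed.

Lemma functional_sum n (c : 'I_n -> R[i]) (x : 'I_n -> V) :
  ell (\sum_(i < n) c i *: x i) = \sum_(i < n) c i * ell (x i).
Proof.
elim: n c x => [|n IH] c x; first by rewrite !big_ord0 functional0.
by rewrite !big_ord_recl ellP IH.
Qed.

Lemma int_on_indic (A : set TR) : measurable A -> (mu A < +oo)%E ->
  int_on D (fun t => \1_A t) /\
  \int[mu]_(t in D) \1_A t = fine (mu (D `&` A)).
Proof.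
move=> mA fA.
have E : (\int[mu]_(t in D) (\1_A t)%:E)%E = mu (D `&` A).
  by rewrite integral_indic// setIC.
split; last by rewrite /Rintegral E.
apply/int_on_ge0P => //; first exact: measurable_indic.
rewrite E (le_lt_trans _ fA)// le_measure ?inE//; exact: measurableI.
Qed.

Lemma sf_pairing (s : @simple_function R V) :
  cint_on D (fun t => ell (sf_eval s t)) /\
  cint (fun t => ell (sf_eval s t)) = ell (sf_integral D s).
Proof.
pose F (i : 'I_(sf_size s)) t := ((\1_(sf_set i) t : R)%:C * ell (sf_val i)).
have FP i : cint_on D (F i) /\
    cint (F i) = (fine (mu (D `&` sf_set i)))%:C * ell (sf_val i).
  have [i1 i2] := int_on_indic (sf_measurable i) (sf_finite i).
  have FE : F i = (fun t => ell (sf_val i) * (\1_(sf_set i) t : R)%:C).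
    by apply/funext => t; rewrite mulrC.
  have ci : cint_on D (fun t => (\1_(sf_set i) t : R)%:C).
    split => //=.
    rewrite /int_on (_ : EFin \o _ = cst 0%E); first exact: integrable0.
    by apply/funext.
  rewrite FE; split; first exact: cint_onZ.
  rewrite cintZ// mulrC; congr (_ * _); apply: complexP => //=.
  by rewrite (_ : (fun t => _) = cst 0)// Rintegral_cst// mul0r.
have GE : (fun t => ell (sf_eval s t)) = (fun t => \sum_(i < sf_size s) F i t).
  by apply/funext => t; rewrite /sf_eval functional_sum.
rewrite GE /sf_integral functional_sum.
suff : forall r : seq 'I_(sf_size s), cint_on D (fun t => \sum_(i <- r) F i t) /\
    cint (fun t => \sum_(i <- r) F i t) =
    \sum_(i <- r) (fine (mu (D `&` sf_set i)))%:C * ell (sf_val i).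
  by move=> /(_ (index_enum _)).
elim=> [|i r [IH1 IH2]].
  have z : int_on D (fun=> 0 : R).
    by rewrite /int_on (_ : EFin \o _ = cst 0%E)//; exact: integrable0.
  split; first by under eq_fun => t do rewrite big_nil; split.
  rewrite big_nil; under eq_fun => t do rewrite big_nil.
  by apply: complexP => /=; rewrite Rintegral_cst// mul0r.
have [i1 i2] := FP i.
have E : (fun t => \sum_(j <- i :: r) F j t) = (fun t => F i t + \sum_(j <- r) F j t).
  by apply/funext => t; rewrite big_cons.
by rewrite E big_cons cintD// i2 IH2; split => //; exact: cint_onD.
Qed.

(** The functional commutes with the integral of simple functions s_n, and
    |ell (F t) - ell (s_n t)| <= K |F t - s_n t|, whose integral tends to 0. *)
Lemma bochner_pairing (F : R -> V) (v : V) (g : TR -> R[i]) :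
  bochner_integral D F v -> cint_on D g ->
  {ae mu, forall t, D t -> ell (F t) = g t} -> ell v = cint g.
Proof.
move=> [s [_ sI sv]] ig Fg.
have [K1 K10 ellK1] : exists2 K1 : R, 0 < K1 & forall x, nrm (ell x) <= K1 * nrm x.
  exists (`|K| + 1) => [|x]; first by rewrite ltr_wpDl.
  rewrite (le_trans (ellK x))// ler_wpM2r ?nrm_ge0//.
  by rewrite (le_trans (ler_norm _))// lerDl.
apply/eqP; rewrite -subr_eq0; apply/eqP/nrm_small_eq0 => e e0.
pose d := e / (3 * K1).
have d0 : 0 < d by rewrite divr_gt0// mulr_gt0.
have near1 : \forall n \near \oo,
    (\int[mu]_(t in D) (Re `|F t - sf_eval (s n) t|)%:E < d%:E)%E.
  apply: (sI [set x | (x < d%:E)%E]); apply: open_nbhs_nbhs; split.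
    exact: open_ereal_lt_ereal.
  by rewrite /= lte_fin.
have /cvg_nrmP/(_ _ d0) near2 := sv.
have [n [In sn]] : exists n, (\int[mu]_(t in D) (Re `|F t - sf_eval (s n) t|)%:E < d%:E)%E /\
    nrm (sf_integral D (s n) - v) < d.
  have [N _ NP] := filterI near1 near2.
  by exists N; have := NP N (leqnn N).
pose G t := ell (sf_eval (s n) t).
have [iG GE] := sf_pairing (s n).
have bound (p : R[i] -> R) : (forall z, `|p z| <= nrm z) ->
    int_on D (fun t => p (g t - G t)) ->
    `|\int[mu]_(t in D) p (g t - G t)| <= K1 * d.
  move=> pn ip.
  have iap : int_on D (fun t => `|p (g t - G t)|).
    by have := integrable_norm ip.
  rewrite (le_trans (le_normr_Rintegral mD ip))// mulrC -ler_pdivrMr// mulrC.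
  rewrite -RintegralZl// -lee_fin -int_onE//; last exact: int_onZ.
  rewrite (le_trans _ (ltW In))//.
  apply: ae_le_integral_nonneg.
  - exact: (int_on_measurable (int_onZ mD K1^-1 iap)).
  - by move=> t; rewrite mulr_ge0// invr_ge0 ltW.
  - by move=> t; exact: nrm_ge0.
  apply: filterS Fg => t Fg Dt; rewrite -(Fg Dt) /G -functionalB.
  by rewrite ler_pdivrMl// (le_trans (pn _))//; exact: ellK1.
have igG : cint_on D (fun t => g t - G t).
  have := cint_onD mD ig (cint_onZ mD (-1) iG).
  by under eq_fun => t do rewrite mulN1r.
have E : cint g - cint G = cint (fun t => g t - G t).
  have := cintD mD ig (cint_onZ mD (-1) iG); rewrite cintZ// mulN1r => <-.
  by apply: eq_cint => t _; rewrite mulN1r.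
have b1 : nrm (cint g - cint G) <= 2 * (K1 * d).
  rewrite E (le_trans (ler_nrm_ReIm _))// mulr2n mulrDl mul1r lerD//=.
    by apply: bound; [exact: ler_Re_nrm|case: igG].
  by apply: bound; [exact: ler_Im_nrm|case: igG].
have b2 : nrm (ell v - cint G) <= K1 * d.
  by rewrite /G GE -functionalB (le_trans (ellK1 _))// ler_wpM2l ?ltW// -nrmN opprB.
have -> : ell v - cint g = (ell v - cint G) - (cint g - cint G) by ring.
rewrite (le_trans (ler_nrmB _ _))// (le_trans (lerD b2 b1))//.
suff -> : K1 * d + 2 * (K1 * d) = e by [].
by rewrite /d; field; rewrite gt_eqF.
Qed.

End BochnerPairing.

(** * From null-controllability to moments *)

Section Restriction.
Context {R : realType}.
Local Notation mu := (@lebesgue_measure R).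
Local Notation TR := (measurableTypeR R).

Lemma int_on_restrict (D E : set TR) (a : TR -> R) : measurable D -> measurable E ->
  int_on D a -> int_on E (a \_ D).
Proof.
move=> mD mE ia.
have := (integrable_restrict mu mD mE (EFin \o a)).1.
rewrite /int_on restrict_EFin; apply.
by apply: integrableS ia => //; exact: measurableI.
Qed.

Lemma real_L2_restrict (D E : set TR) (a : TR -> R) : measurable D -> measurable E ->
  real_L2 D a -> real_L2 E (a \_ D).
Proof.
move=> mD mE [ma ia]; split.
  have [H _] := measurable_restrict a mD mE; apply: H.
  by apply: measurable_funS ma => //; exact: subIsetr.
have := int_on_restrict mD mE ia.
by congr int_on; apply/funext => t; rewrite /patch; case: ifP => // _; rewrite expr0n.
Qed.

Definition extend0 (D : set TR) (u : TR -> R[i]) : TR -> R[i] :=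
  fun t => if t \in D then u t else 0.

Lemma extend0_Re D u : (fun t => Re (extend0 D u t)) = (fun t => Re (u t)) \_ D.
Proof. by apply/funext => t; rewrite /extend0 /patch; case: ifP. Qed.

Lemma extend0_Im D u : (fun t => Im (extend0 D u t)) = (fun t => Im (u t)) \_ D.
Proof. by apply/funext => t; rewrite /extend0 /patch; case: ifP. Qed.

Lemma cL2_extend0 D E u : measurable D -> measurable E ->
  cL2 D u -> cL2 E (extend0 D u).
Proof.
move=> mD mE [Lr Li]; split; rewrite ?extend0_Re ?extend0_Im;
  exact: real_L2_restrict.
Qed.

Lemma cint_extend0 D E u : measurable D -> measurable E -> D `<=` E ->
  cint_on D u -> cint_on E (extend0 D u) /\
  complex_integral E (extend0 D u) = complex_integral D u.
Proof.
move=> mD mE DE [ir ii]; split.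
  by split; rewrite ?extend0_Re ?extend0_Im; exact: int_on_restrict.
rewrite /complex_integral extend0_Re extend0_Im -!Rintegral_mkcondr.
by rewrite (setIidr DE).
Qed.

Lemma real_L2_continuous (s : R) (a : TR -> R) : continuous (a : R -> R) ->
  real_L2 `[0, s] a.
Proof.
move=> ca; split.
  by apply: measurable_funTS; exact: continuous_measurable_fun.
apply: continuous_compact_integrable; first exact: segment_compact.
apply: continuous_subspaceT => t.
have -> : (fun t => a t ^+ 2) = (fun t => a t * a t) by apply/funext => x; rewrite expr2.
by apply: continuousM; exact: ca.
Qed.

End Restriction.

Section Pairing.
Context {R : realType} {X V : completeNormedModType R[i]}.
Variables (ip : {dot X for @Num.conj R[i]}) (Ad : X -> X -> Prop).
Variables (iota : {linear X -> V}) (pr : V -> X -> R[i]).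
Hypothesis dualV : pivot_dual ip Ad iota pr.

Lemma pivot_pr_linear w : dom Ad w ->
  forall a x y, pr (a *: x + y) w = a * pr x w + pr y w.
Proof. by move=> dw a x y; exact: (pivot_linear dualV dw). Qed.

(** [v] has operator norm [`|v|] on the domain of [Ad] with its graph norm; for fixed
    [w] this bounds [pr v w] linearly in the norm of [v]. *)
Lemma pivot_pr_bounded w : dom Ad w ->
  exists K : R, forall v, nrm (pr v w) <= K * nrm v.
Proof.
move=> [z wz]; exists (nrm (graph_norm w z)) => v.
have [/(_ (lexx _)) + _] := pivot_norm dualV v (normr_ge0 v).
move=> /(_ _ _ wz).
have g0 : 0 <= graph_norm w z by rewrite sqrtC_ge0 addr_ge0 ?exprn_ge0.
have gE : graph_norm w z = (nrm (graph_norm w z))%:C by rewrite -nrmE ger0_norm.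
by rewrite {1}gE !nrmE -rmorphM lecR mulrC.
Qed.

End Pairing.

Section Modes.
Context {R : realType} {X V : completeNormedModType R[i]}.
Local Notation mu := (@lebesgue_measure R).
Local Notation TR := (measurableTypeR R).
Variables (ip : {dot X for @Num.conj R[i]}).
Variables (S : R -> {linear X -> X}) (A : X -> X -> Prop).
Variables (iota : {linear X -> V}) (pr : V -> X -> R[i]) (SV : R -> {linear V -> V}) (b : V).
Variables (lam : nat -> R[i]) (phi psi : nat -> X).
Hypothesis hilbertX : hilbert_product ip.
Hypothesis semigroupS : C0_semigroup S.
Hypothesis generatorA : A = generator S.
Hypothesis dualV : pivot_dual ip (adjoint ip A) iota pr.
Hypothesis extensionSV : semigroup_extension S SV iota.
Hypothesis eigen_phi : forall j, eigenvector A (lam j) (phi j).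
Hypothesis eigen_psi : forall j,
    eigenvector (adjoint ip A) (Num.conj (lam j)) (psi j).
Hypothesis biorthogonal : forall k j, ip (phi k) (psi j) = (k == j)%:R.
Hypothesis phi_dense : forall (x : X) (d : R), 0 < d ->
  exists2 y, (exists n (c : nat -> R[i]), y = \sum_(j < n) c j *: phi j) &
    nrm (x - y) < d.

Lemma psi_dom j : dom (adjoint ip A) (psi j).
Proof. by exists (Num.conj (lam j) *: psi j); case: (eigen_psi j). Qed.

(** On the span of the phi_k the law is the action of [S t] on eigenvectors. *)
Lemma mode_evolution t x j : 0 <= t ->
  ip (S t x) (psi j) = cexp (lam j * t%:C) * ip x (psi j).
Proof.
move=> t0; set E := cexp _.
have [K K0 KP] := continuous_nrmP (C0_bounded semigroupS t0).
apply/eqP; rewrite -subr_eq0; apply/eqP.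
apply: (@dense_eq0 _ _ (fun x => ip (S t x) (psi j) - E * ip x (psi j))
  (K * nrm (psi j) + nrm E * nrm (psi j)) _ phi_dense).
- by move=> y z; rewrite linearB/= !linearBl/=; ring.
- move=> y; rewrite (le_trans (ler_nrmB _ _))// nrmM mulrDl lerD//.
    rewrite (le_trans (cauchy_schwarz hilbertX _ _))// mulrAC.
    by rewrite ler_wpM2r ?nrm_ge0.
  rewrite -mulrA ler_wpM2l ?nrm_ge0// mulrC.
  exact: cauchy_schwarz.
- move=> _ [n [c ->]]; rewrite linear_sum/= !ip_suml mulr_sumr -sumrB big1// => k _.
  have fk : generator S (phi k) (lam k *: phi k).
    by rewrite -generatorA; case: (eigen_phi k).
  rewrite linearZ/= (semigroup_eigen semigroupS fk t0) !ipZl biorthogonal.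
  by case: eqVneq => [->|_]; [rewrite !mulr1 /E; ring|rewrite !mulr0 subr0].
Qed.

(** [iota] has dense range, and there the law is that of [mode_evolution]. *)
Lemma mode_evolution_dual t v j : 0 <= t ->
  pr (SV t v) (psi j) = cexp (lam j * t%:C) * pr v (psi j).
Proof.
move=> t0; set E := cexp _.
have [CV SVi] := extensionSV.
have [K K0 KP] := continuous_nrmP (C0_bounded CV t0).
have [M MP] := pivot_pr_bounded dualV (psi_dom j).
have prL := pivot_pr_linear dualV (psi_dom j).
apply/eqP; rewrite -subr_eq0; apply/eqP.
apply: (@dense_eq0 _ _ (fun v => pr (SV t v) (psi j) - E * pr v (psi j))
  (`|M| * K + nrm E * M) (range iota)).
- by move=> y d d0; apply: dense_nrmP d0; exact: (pivot_iota_dense dualV).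
- by move=> y z; rewrite linearB/= !(functionalB prL); ring.
- move=> y; rewrite (le_trans (ler_nrmB _ _))// nrmM mulrDl lerD//.
    rewrite (le_trans (MP _))// -mulrA.
    rewrite (le_trans (ler_wpM2r (nrm_ge0 _) (ler_norm M)))//.
    by rewrite ler_wpM2l.
  by rewrite -mulrA ler_wpM2l ?nrm_ge0.
- move=> _ [x _ <-]; rewrite SVi// !(pivot_inner dualV) ?mode_evolution// ?subrr//;
    exact: psi_dom.
Qed.

Definition mode_fun j (t : TR) : R[i] := cexp (- lam j * t%:C) * pr b (psi j).

Lemma mode_fun_L2 s j : cL2 (`[0, s] : set TR) (mode_fun j).
Proof.
have cr l (f : R -> R) : continuous f ->
    continuous (fun t : R => expR (- Re l * t) * f (- Im l * t) : R).
  move=> cf t; apply: (@continuousM _ _ (fun t : R => expR (- Re l * t))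
    (fun t : R => f (- Im l * t))).
    by apply: continuous_comp; [exact: mulrl_continuous|exact: continuous_expR].
  by apply: continuous_comp; [exact: mulrl_continuous|exact: cf].
have -> : mode_fun j = (fun t => pr b (psi j) * cexp (- lam j * t%:C)).
  by apply/funext => t; rewrite /mode_fun mulrC.
apply: cL2Z; first exact: measurable_itv.
set l := lam j; split.
  have -> : (fun t => Re (cexp (- l * t%:C))) =
      (fun t => expR (- Re l * t) * cos (- Im l * t)).
    by apply/funext => t; rewrite /cexp ReM ImM/= ReN ImN !mulr0 subr0 add0r.
  exact/real_L2_continuous/cr/continuous_cos.
have -> : (fun t => Im (cexp (- l * t%:C))) =
    (fun t => expR (- Re l * t) * sin (- Im l * t)).
  by apply/funext => t; rewrite /cexp ReM ImM/= ReN ImN !mulr0 subr0 add0r.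
exact/real_L2_continuous/cr/continuous_sin.
Qed.

(** The integrand SV (t1 - t) (u t b) pairs with psi_j to
    exp (lam_j (t1 - t)) u(t) b_j = exp (lam_j t1) f_j(t) u(t) on [0, t2], and to 0
    almost everywhere after t2. *)
Lemma input_moment t1 t2 (u : TR -> R[i]) (v : V) j : 0 <= t2 <= t1 ->
  square_integrable `[0, t2] u -> {ae mu, forall t, t2 <= t -> u t = 0} ->
  input_map SV b t1 u v ->
  pr v (psi j) = cexp (lam j * t1%:C) *
    L2_product `[0, t2] (mode_fun j) (fun t => Num.conj (u t)).
Proof.
move=> /andP[t20 t21] /square_integrableP Lu u0 uv.
pose D1 : set TR := `[0, t1]%classic; pose D2 : set TR := `[0, t2]%classic.
have mD1 : measurable D1 by exact: measurable_itv.
have mD2 : measurable D2 by exact: measurable_itv.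
have sD : D2 `<=` D1.
  by move=> t; rewrite /D1 /D2 /= !in_itv/= => /andP[-> /le_trans]; apply.
have {}Lu : cL2 D2 u by apply: Lu.
pose E1 := cexp (lam j * t1%:C).
have ifu : cint_on D2 (fun t => mode_fun j t * u t).
  by apply: cL2_mul => //; exact: mode_fun_L2.
pose h t := E1 * (mode_fun j t * u t).
have ih : cint_on D2 h by exact: cint_onZ.
have [ig gE] := cint_extend0 mD2 mD1 sD ih.
have [M MP] := pivot_pr_bounded dualV (psi_dom j).
have prL := pivot_pr_linear dualV (psi_dom j).
rewrite (bochner_pairing mD1 prL MP uv ig).
  rewrite gE /h cintZ//; congr (_ * _); apply: eq_cint => t _.
  by rewrite [Num.conj (Num.conj _)]conjCK.
case: u0 => B [mB B0 BP]; exists B; split => // t /= H; apply: BP => /= u0.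
apply: H; rewrite /D1/= in_itv/= => /andP[t0 tt1].
rewrite mode_evolution_dual ?subr_ge0//.
have -> : pr (u t *: b) (psi j) = u t * pr b (psi j).
  by rewrite -[u t *: b]addr0 prL (functional0 prL) addr0.
rewrite /extend0; case: ifPn => [_|].
  rewrite /h /mode_fun /E1 rmorphB/= mulrBr cexpD mulNr; ring.
rewrite notin_setE /D2/= in_itv/= t0/= => /negP; rewrite -ltNge => /ltW /u0 ->.
by rewrite mul0r mulr0.
Qed.

Variables (t1 t2 : R).
Hypothesis t2_ge0 : 0 <= t2.
Hypothesis t2_le_t1 : t2 <= t1.
Local Notation D := (`[0, t2]%classic : set TR).
Hypothesis admissible : admissible_input SV iota b.
Hypothesis psi_complete : forall x, (forall j, ip x (psi j) = 0) -> x = 0.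

Lemma mild_solution_moments x0 (u : TR -> R[i]) x : square_integrable D u ->
  {ae mu, forall t, t2 <= t -> u t = 0} -> mild_solution S SV iota b t1 x0 u x ->
  forall j, ip x (psi j) = cexp (lam j * t1%:C) *
    (ip x0 (psi j) + L2_product D (mode_fun j) (fun t => Num.conj (u t))).
Proof.
move=> uL u0 [v uv xv] j.
have dj := psi_dom j; have prL := pivot_pr_linear dualV dj.
have t1_ge0 := le_trans t2_ge0 t2_le_t1.
rewrite -(pivot_inner dualV _ dj) xv -[iota _]scale1r prL mul1r.
rewrite (pivot_inner dualV _ dj) mode_evolution// mulrDr.
by rewrite (input_moment j _ uL u0 uv)// t2_ge0.
Qed.

(** The factors exp (lam_j t1) do not vanish, so the state at time t1 is 0 exactly
    when u solves the moment problem with right-hand sides - (x0, psi_j).  In the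
    direction from moments to controls, admissibility provides the state, which is 0
    because all its psi_j-coordinates are. *)
Theorem null_controllable_moments : exact_null_controllable S SV iota b t1 t2 <->
  forall x, exists2 h, cL2 D h &
    forall j, L2_product D (mode_fun j) h = ip x (psi j).
Proof.
have mD : measurable D by exact: measurable_itv.
have t1_ge0 := le_trans t2_ge0 t2_le_t1.
have exp_neq0 j : cexp (lam j * t1%:C) != 0.
  apply/eqP => E0; have := nrm_cexp (lam j * t1%:C).
  by rewrite E0 nrm0 => /esym/eqP; rewrite gt_eqF ?expR_gt0.
split=> [ctrl x|solve x0].
  have [u [uL u0 ux]] := ctrl (- x).
  exists (fun t => Num.conj (u t)) => [|j].
    exact/cL2_conj/(square_integrableP mD u).1.
  have := mild_solution_moments uL u0 ux j.
  rewrite linear0l => /esym/eqP; rewrite mulf_eq0 (negPf (exp_neq0 j))/=.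
  by rewrite linearNl/= addrC subr_eq0 => /eqP.
have [h Lh hP] := solve (- x0).
pose u := extend0 D (fun t => Num.conj (h t)).
have uL (s : R) : square_integrable `[0, s] u.
  have mE : measurable (`[0, s]%classic : set TR) by exact: measurable_itv.
  by apply/(square_integrableP mE)/cL2_extend0 => //; exact: cL2_conj.
have u0 : {ae mu, forall t, t2 <= t -> u t = 0}.
  exists [set t2]; split.
  - exact: measurable_set1.
  - exact: lebesgue_measure_set1.
  move=> t /= H; apply: contrapT => tt2; apply: H => t2t; rewrite /u /extend0.
  case: ifPn => // /set_mem; rewrite /= in_itv/= => /andP[_ tt].
  by case: tt2; apply/eqP; rewrite eq_le tt.
have [x ux] := admissible (fun s _ => uL s) t1_ge0.
have sol : mild_solution S SV iota b t1 x0 u (S t1 x0 + x).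
  by exists (iota x); rewrite ?linearD.
exists u; split => //.
suff <- : S t1 x0 + x = 0 by [].
apply: psi_complete => j; rewrite (mild_solution_moments (uL t2) u0 sol).
suff -> : L2_product D (mode_fun j) (fun t => Num.conj (u t)) = - ip x0 (psi j).
  by rewrite addrN mulr0.
have <- : ip (- x0) (psi j) = - ip x0 (psi j) by rewrite linearNl.
rewrite -hP; apply: eq_cint => t Dt.
by rewrite /u /extend0 mem_set// ![Num.conj (Num.conj _)]conjCK.
Qed.

End Modes.

(** * The main equivalence *)

Section RieszMoments.
Context {R : realType} {X : completeNormedModType R[i]}.
Local Notation TR := (measurableTypeR R).
Variables (ip : {dot X for @Num.conj R[i]}) (phi psi : nat -> X).
Hypothesis hilbertX : hilbert_product ip.
Hypothesis riesz_phi : riesz_basis ip phi.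
Hypothesis biorthogonal : forall k j, ip (phi k) (psi j) = (k == j)%:R.
Variables (D : set TR) (f : nat -> TR -> R[i]).
Hypothesis mD : measurable D.
Hypothesis fL2 : forall j, cL2 D (f j).

Definition combination n (a : nat -> R[i]) : TR -> R[i] :=
  fun t => \sum_(j < n) a j * f j t.
Definition coercive := exists2 g : R, 0 < g &
  forall n a, g * l2sum n a <= L2_norm2 D (combination n a).

Lemma combination_L2 n a : cL2 D (combination n a).
Proof.
by apply: (@cL2_sum _ _ mD n (fun j t => a j * f j t)) => j; exact: cL2Z.
Qed.

Lemma combination_moment n a h : cL2 D h ->
  L2_product D (combination n a) h = \sum_(j < n) a j * L2_product D (f j) h.
Proof.
move=> Lh; rewrite (@L2_ip_suml _ _ mD n (fun j t => a j * f j t))//; last first.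
  by move=> j; exact: cL2Z.
by apply: eq_bigr => j _; rewrite L2_ipZl.
Qed.

Lemma gram_form_L2 n a :
  gram_form (@L2_product R D) f n a = (L2_norm2 D (combination n a))%:C.
Proof.
rewrite -(L2_ip_norm2 mD) combination_moment; last exact: combination_L2.
apply: eq_bigr => i _; rewrite L2_ipC//; last exact: combination_L2.
rewrite combination_moment// rmorph_sum/= mulr_sumr; apply: eq_bigr => j _.
by rewrite rmorphM/= -L2_ipC// mulrA.
Qed.

Lemma strongly_minimal_L2 : strongly_minimal (@L2_product R D) f <-> coercive.
Proof.
have /strongly_minimal_coercive SMC i j :
    L2_product D (f i) (f j) = Num.conj (L2_product D (f j) (f i)).
  exact: L2_ipC.
split=> [/SMC[g g0 gP]|[g g0 gP]].
  by exists g => // n a; have := gP n a; rewrite gram_form_L2 lecR.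
by apply/SMC; exists g => // n a; rewrite gram_form_L2 lecR.
Qed.

(** Rescaling by the norm q of the combination would fail at q = 0; rescaling by
    every r > 0 above q and letting r decrease to q covers this case, where it gives
    a = 0. *)
Lemma coercive_unit_ball B : 0 < B ->
  (forall n a, L2_norm2 D (combination n a) <= 1 -> l2sum n a <= B) -> coercive.
Proof.
move=> B0 unit; exists B^-1; first by rewrite invr_gt0.
move=> n a; rewrite ler_pdivrMl//.
set q := L2_norm2 D _.
have q0 : 0 <= q by exact: L2_norm2_ge0.
have scaled (r : R) : 0 < r -> q <= r -> l2sum n a <= B * r.
  move=> r0 qr; pose s := (Num.sqrt r)^-1.
  have ns : nrm s%:C ^+ 2 = r^-1.
    by rewrite nrm_real real_normK ?num_real// exprVn sqr_sqrtr// ltW.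
  have := unit n (fun j => s%:C * a j).
  have -> : combination n (fun j => s%:C * a j) = (fun t => s%:C * combination n a t).
    apply/funext => t; rewrite /combination mulr_sumr; apply: eq_bigr => j _.
    exact/esym/mulrA.
  have -> : l2sum n (fun j => s%:C * a j) = r^-1 * l2sum n a.
    by rewrite /l2sum mulr_sumr; apply: eq_bigr => j _; rewrite nrmM exprMn ns.
  rewrite (L2_norm2Z mD); last exact: combination_L2.
  rewrite ns -/q ler_pdivrMl// mulr1 => /(_ qr).
  by rewrite ler_pdivrMl// [r * _]mulrC.
apply/ler_addgt0Pr => d d0.
have d1 : 0 < d / B by rewrite divr_gt0.
have := scaled (q + d / B).
rewrite ltr_wpDl// lerDl ltW// mulrDr [_ * (d / _)]mulrC divfK ?gt_eqF//.
by apply.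
Qed.

(** Forward, the seminorms are |sum a_j (x, psi_j)| indexed by the finite
    families with || sum a_j f_j || <= 1.  Testing their uniform bound M at an x with
    psi_j-coordinates conj a_j and |x|^2 <= K sum |a_j|^2 gives
    (sum |a_j|^2)^2 <= M^2 K sum |a_j|^2.  Backward, Bessel's inequality
    and the lower bound give the estimate required by [moment_problem]. *)
Theorem moments_solvable_coercive :
  (forall x, exists2 h, cL2 D h &
    forall j, L2_product D (f j) h = ip x (psi j)) <-> coercive.
Proof.
have [e [Q [Q' [onb [cQ cQ'] QK Q'K Qe]]]] := riesz_phi.
split=> [solve|[g g0 gP] x].
  pose I := {na : nat * (nat -> R[i]) | L2_norm2 D (combination na.1 na.2) <= 1}.
  pose F n (a : nat -> R[i]) x := \sum_(j < n) a j * ip x (psi j).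
  have FE n a x : F n a x = ip x (\sum_(j < n) Num.conj (a j) *: psi j).
    rewrite ip_sumr; apply: eq_bigr => j _.
    by rewrite ipZr [Num.conj (Num.conj _)]conjCK.
  pose p (i : I) x := nrm (F (sval i).1 (sval i).2 x).
  have pD i x y : p i (x + y) <= p i x + p i y.
    by rewrite /p !FE ipDl ler_nrmD.
  have pZ i (c : R) x : p i (c%:C *: x) = `|c| * p i x.
    by rewrite /p !FE ipZl nrmM nrm_real.
  have pb i : exists K, forall x, p i x <= K * nrm x.
    exists (nrm (\sum_(j < (sval i).1) Num.conj ((sval i).2 j) *: psi j)) => x.
    by rewrite /p FE mulrC; exact: cauchy_schwarz.
  have pw x : exists M, forall i, p i x <= M.
    have [h Lh hP] := solve x.
    (* The bound on y below is y <= 1 + y ^+ 2 together with y ^+ 2 <= 2 * N. *)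
    exists (1 + 2 * L2_norm2 D h) => -[[n a] /= na].
    have -> : p (exist _ (n, a) na) x = nrm (L2_product D (combination n a) h).
      rewrite /p /F/= combination_moment//; congr nrm.
      by apply: eq_bigr => j _; rewrite hP.
    have := L2_weak_bound mD Lh (combination_L2 n a).
    set y := nrm _; set q := L2_norm2 D (combination n a); set N := L2_norm2 _ _ => H.
    have N0 : 0 <= N by exact: L2_norm2_ge0.
    have H1 : y ^+ 2 <= 2 * N.
      by rewrite (le_trans H)// ler_wpM2r// -[2]/(1 + 1) lerD2l.
    by have := sqr_ge0 (y - 1); nra.
  have [M M0 MP] := uniform_boundedness pD pZ pb pw.
  have [K K0 KP] := riesz_dual hilbertX onb cQ QK Q'K Qe biorthogonal.
  have B0 : 0 < M ^+ 2 * K by rewrite mulr_gt0// exprn_gt0.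
  apply: (coercive_unit_ball B0) => n a na; have [x Fx nx] := KP n a.
  have := MP (exist _ (n, a) na) x; rewrite /p/= /F Fx nrm_real.
  rewrite -/(l2sum n a) in nx *; rewrite ger0_norm ?l2sum_ge0// => H.
  have H2 : l2sum n a ^+ 2 <= M ^+ 2 * K * l2sum n a.
    rewrite (@le_trans _ _ ((M * nrm x) ^+ 2))//.
      by rewrite ler_pXn2r ?nnegrE ?l2sum_ge0// mulr_ge0 ?nrm_ge0// ltW.
    by rewrite exprMn -mulrA ler_wpM2l ?exprn_ge0// ltW.
  have [->|l0] := eqVneq (l2sum n a) 0; first exact: ltW.
  move: H2; rewrite expr2 ler_pM2r// lt_neqAle eq_sym l0; exact: l2sum_ge0.
have [C C0 CP] := riesz_upper hilbertX onb cQ Q'K Qe biorthogonal x.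
have Cg n (a : nat -> R[i]) : nrm (\sum_(j < n) a j * ip x (psi j)) ^+ 2 <=
    C / g * L2_norm2 D (combination n a).
  rewrite (le_trans (CP n a))// -mulrA ler_wpM2l//.
  by rewrite ler_pdivlMl// gP.
have Cg0 : 0 <= C / g by rewrite divr_ge0// ltW.
exact: (@moment_problem R D mD f (fun j => ip x (psi j)) (C / g) fL2 Cg0 Cg).
Qed.

End RieszMoments.

Theorem theorem3 (R : realType)
  (X : completeNormedModType R[i]) (ip : {dot X for @Num.conj R[i]})
  (S : R -> {linear X -> X}) (A : X -> X -> Prop)
  (V : completeNormedModType R[i]) (iota : {linear X -> V})
  (pr : V -> X -> R[i]) (SV : R -> {linear V -> V}) (b : V)
  (lam : nat -> R[i]) (phi psi : nat -> X) (T t1 : R)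
  (hilbertX : hilbert_product ip)
  (separableX : separable_space X)
  (semigroupS : C0_semigroup S)
  (generatorA : A = generator S)
  (dualV : pivot_dual ip (adjoint ip A) iota pr)
  (extensionSV : semigroup_extension S SV iota)
  (admissible : admissible_input SV iota b)
  (spectrumA : simple_discrete_spectrum A)
  (enum_lam : eigenvalue_enumeration A lam)
  (eigen_phi : forall j, eigenvector A (lam j) (phi j))
  (eigen_psi : forall j,
    eigenvector (adjoint ip A) (Num.conj (lam j)) (psi j))
  (biorthogonal : forall k j, ip (phi k) (psi j) = (k == j)%:R)
  (T_ge0 : 0 <= T)
  (expansion : eigenvector_expansion S phi T)
  (T_lt_t1 : T < t1)
  (riesz_phi : riesz_basis ip phi) :
  exact_null_controllable S SV iota b t1 (t1 - T) <->
  strongly_minimal (@L2_product R `[0, t1 - T])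
    (fun j t => cexp (- lam j * t%:C) * pr b (psi j)).
Proof.
have [e [Q [Q' [onb [cQ _] _ Q'K Qe]]]] := riesz_phi.
have t2_ge0 : 0 <= t1 - T by rewrite subr_ge0 ltW.
have t2_le_t1 : t1 - T <= t1 by rewrite gerBl.
have mD : measurable (`[0, t1 - T]%classic : set (measurableTypeR R)).
  exact: measurable_itv.
have fL2 := mode_fun_L2 pr b lam psi (t1 - T).
apply: iff_trans (null_controllable_moments hilbertX semigroupS generatorA
  dualV extensionSV eigen_phi eigen_psi biorthogonal (riesz_dense onb cQ Q'K Qe)
  t2_ge0 t2_le_t1 admissible
  (riesz_complete hilbertX onb cQ Q'K Qe biorthogonal)) _.
apply: iff_trans
  (moments_solvable_coercive hilbertX riesz_phi biorthogonal mD fL2) _.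
exact: iff_sym (strongly_minimal_L2 mD fL2).
Qed.
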